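(* There exists a non-metrisable surface carrying a minimal foliation (of dimension $1$) all of whose leaves are real lines (homeomorphic to $\mathbb R$).
   Context: Manifolds are connected Hausdorff, locally Euclidean spaces (not assumed metrisable or second countable), without boundary. A surface is a $2$-dimensional manifold. A foliation (always of dimension $1$, topological) on an $n$-manifold $M$ is given by a maximal atlas of foliated charts $\varphi:U\to\mathbb R\times\mathbb R^{n-1}$ (homeomorphisms from open sets $U$ covering $M$ onto open boxes) whose coordinate changes are locally of the form $(x,y)\mapsto(f(x,y),g(y))$ with $y\in\mathbb R^{n-1}$. Plaques are the sets $\varphi^{-1}(\mathbb R\times\{y\})$; the leaf topology on $M$ is the topology generated by the open subsets of plaques, and leaves are the connected components of $M$ in the leaf topology, each a connected $1$-manifold. The homeomorphism type of a leaf refers to its leaf topology. A foliation is minimal if every leaf is dense in the manifold. *)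

(* Defs.v *)
From HB Require Import structures.
From mathcomp Require Import all_boot all_order all_algebra.
From mathcomp Require Import all_classical all_reals all_analysis.

Set Implicit Arguments.
Unset Strict Implicit.
Unset Printing Implicit Defensive.

Import Order.TTheory GRing.Theory Num.Theory.
Import numFieldNormedType.Exports.

Local Open Scope classical_set_scope.
Local Open Scope ring_scope.

(* [f] restricts to a homeomorphism from the subspace [U] onto the subspace
   [V]; its values outside [U] are irrelevant. *)
Definition homeo_on (X Y : topologicalType) (U : set X) (V : set Y)
    (f : X -> Y) : Prop :=
  {within U, continuous f} /\
  exists g : Y -> X,
    [/\ {within V, continuous g}, set_fun U V f, set_fun V U g,
        {in U, cancel f g} & {in V, cancel g f}].

Definition homeomorphic (X Y : topologicalType) (U : set X) (V : set Y) : Prop :=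
  exists f : X -> Y, homeo_on U V f.

Definition metrizable (R : realType) (M : topologicalType) : Prop :=
  exists d : M -> M -> R,
    [/\ forall x y, 0 <= d x y,
        forall x y, d x y = 0 <-> x = y,
        forall x y, d x y = d y x,
        forall x y z, d x z <= d x y + d y z
      & forall A : set M, open A <->
          (forall x, A x -> exists2 e, 0 < e & [set y | d x y < e] `<=` A)].

(* Neither metrizability nor second countability is required. *)
Definition surface (R : realType) (M : topologicalType) : Prop :=
  [/\ connected [set: M], hausdorff_space M
    & forall x : M, exists U : set M, exists V : set (R * R),
        [/\ open U, U x, open V & homeomorphic U V]].

(* The sides may be unbounded, so that the whole of R * R is a box. *)
Definition open_box (R : realType) (B : set (R * R)) : Prop :=
  exists I J : set R,
    [/\ open I, is_interval I & I !=set0] /\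
    [/\ open J, is_interval J & J !=set0] /\ B = I `*` J.

Section Foliation.
Context (R : realType) (M : topologicalType).

(* A chart is a domain together with a coordinate map; the values of the map
   outside the domain are junk that no definition below depends on. The second
   coordinate is the transverse one. *)
Definition chart : Type := (set M * (M -> R * R))%type.

Definition foliated_chart (c : chart) : Prop :=
  open c.1 /\ exists2 B : set (R * R), open_box B & homeo_on c.1 B c.2.

(* The coordinate change from [c] to [c'] is locally
   (x, y) |-> (f (x, y), g y). *)
Definition foliated_change (c c' : chart) : Prop :=
  forall p : M, (c.1 `&` c'.1) p ->
    exists (f : R * R -> R) (g : R -> R),
      \forall q \near p, c'.2 q = (f (c.2 q), g (c.2 q).2).

Definition foliated_atlas (F : set chart) : Prop :=
  [/\ forall c, F c -> foliated_chart c,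
      forall x : M, exists2 c, F c & c.1 x
    & forall c c', F c -> F c' -> foliated_change c c'].

Definition foliation (F : set chart) : Prop :=
  foliated_atlas F /\
  forall G : set chart, foliated_atlas G -> F `<=` G -> G = F.

Definition plaque (c : chart) (y : R) : set M :=
  c.1 `&` [set q | (c.2 q).2 = y].

Definition open_in_plaque (F : set chart) (A : set M) : Prop :=
  exists c y (O : set M), [/\ F c, open O & A = plaque c y `&` O].

(* [M] as a mere set, to be given the leaf topology of [F] *)
Definition leaf_space (F : set chart) : Type := M.

HB.instance Definition _ (F : set chart) := Choice.on (leaf_space F).

HB.instance Definition _ (F : set chart) :=
  @isSubBaseTopological.Build (leaf_space F) (set M) (open_in_plaque F) id.

End Foliation.

Definition leaf (R : realType) (M : topologicalType) (F : set (chart R M))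
    (x : M) : set (leaf_space F) :=
  connected_component [set: leaf_space F] (x : leaf_space F).
Arguments leaf {R M} F x.

(* density refers to the topology of [M], not to the leaf topology *)
Definition minimal_foliation (R : realType) (M : topologicalType)
    (F : set (chart R M)) : Prop :=
  forall x : M, @dense M (leaf F x).

(* Main.v *)
Require Import Defs.
From HB Require Import structures.
From mathcomp Require Import all_boot all_order all_algebra finmap.
From mathcomp Require Import all_classical all_reals all_analysis.
From mathcomp Require Import ring lra zify.
Import Order.TTheory GRing.Theory Num.Theory.
Import numFieldNormedType.Exports.
Local Open Scope classical_set_scope.
Local Open Scope ring_scope.

Set Implicit Arguments.
Unset Strict Implicit.
Unset Printing Implicit Defensive.

(** The surface is a torus with an irrational linear foliation, in which a
    Cantor set of points has been replaced by rays.

    Let [B] be a closed subset of a transversal circle which meets every orbit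
    of the rotation at most once, and let [s] be the coordinate along the
    leaves of the torus, so that the circle is [s = 0]. The points of [B] on
    that circle are removed. A leaf that was hit is thereby cut into two
    half-leaves, each of them dense since half-orbits of an irrational rotation
    are dense. The half-leaf that starts at the hole is left as it is: it is a
    line. The half-leaf that arrives at the hole [y] is continued by a ray
    [0 <= s] of new points, which belongs to this leaf alone. Near such a ray
    the neighbouring leaves are stretched so as to accompany it: in the chart
    of [y], a leaf at distance [d] from [y] runs through all heights before
    reaching the circle, and the points which it then passes close to the ray
    are points of the torus just below the circle. Two different rays have
    disjoint neighbourhoods because their transverse coordinates differ, so the
    result is Hausdorff, and every leaf is still a dense line.

    The torus minus the holes is a dense open set, so the surface is separable.
    But the tips of the rays form a discrete family of the cardinality of [B],
    each tip being the only one in the chart of its ray. If [B] is uncountable,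
    the surface is therefore not metrisable.

    Both [B] and the angle come from the numbers [2 ^ (2 ^ n)]. A sum of their
    inverses over even [n] and a sum over odd [n] are approximated by
    rationals at very different rates. The angle is the sum over all odd [n],
    and [B] is the set of reals which are as well approximated as the sums over
    sets of even [n] ([near_int_set_orbit], [code_inj]).

    The surface is a gluing of open subsets of the plane along changes of
    coordinates that are translations in the transverse variable. For such a
    gluing, [sheet_foliationP] gives the foliation, and [leaf_sheet_line]
    identifies its leaves: a partition of the surface into lines that locally
    follow the plaques is the partition into leaves. *)

(** * Completing an atlas to a foliation *)

Section Saturation.
Context (R : realType) (M : topologicalType).
Implicit Types A F : set (chart R M).

Definition saturation A : set (chart R M) :=
  [set c | foliated_chart c /\
    forall c0, A c0 -> foliated_change c c0 /\ foliated_change c0 c].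

Lemma foliated_change_trans (c c0 c' : chart R M) (p : M) :
  c0.1 p -> foliated_change c c0 -> foliated_change c0 c' ->
  (c.1 `&` c'.1) p ->
  exists (f : R * R -> R) (g : R -> R),
    \forall q \near p, c'.2 q = (f (c.2 q), g (c.2 q).2).
Proof.
move=> c0p h h' [cp c'p].
have [f [g H]] := h p (conj cp c0p).
have [f' [g' H']] := h' p (conj c0p c'p).
exists (fun q => f' (f q, g q.2)), (g' \o g).
by apply: filterS2 H H' => q -> ->.
Qed.

(** Compatibility with an atlas is transitive because it is a local condition:
    near each point one can compare through a chart of the atlas. *)
Lemma saturation_foliation A : foliated_atlas A -> foliation (saturation A).
Proof.
move=> [Ac Acov Ach].
have sub : A `<=` saturation A.
  move=> c cA; split; first exact: Ac.
  by move=> c0 c0A; split; apply: Ach.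
split; first split.
- by move=> c [].
- by move=> x; have [c cA cx] := Acov x; exists c => //; apply: sub.
- move=> c c' [_ hc] [_ hc'] p pcc'; have [c0 c0A c0p] := Acov p.
  by apply: foliated_change_trans c0p (hc _ c0A).1 (hc' _ c0A).2 pcc'.
- move=> G [Gc Gcov Gch] subG; apply/seteqP; split=> // c cG.
  split; first exact: Gc.
  by move=> c0 c0A; split; apply: Gch => //; apply/subG/sub.
Qed.

End Saturation.

(** * Boxes *)

Section Boxes.
Context (R : realType).
Implicit Types (q : R * R) (e : R).

Definition box q e : set (R * R) :=
  `]q.1 - e, q.1 + e[%classic `*` `]q.2 - e, q.2 + e[%classic.

Lemma boxE q e p :
  box q e p <-> [/\ q.1 - e < p.1, p.1 < q.1 + e, q.2 - e < p.2 & p.2 < q.2 + e].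
Proof.
rewrite /box /= !in_itv /=; split.
  by move=> [/andP[? ?] /andP[? ?]].
by move=> [-> -> -> ->].
Qed.

Lemma boxq q e : 0 < e -> box q e q.
Proof. by move=> e0; apply/boxE; split; lra. Qed.

Lemma sub_box q e e' : e <= e' -> box q e `<=` box q e'.
Proof. by move=> ee' p /boxE[? ? ? ?]; apply/boxE; split; lra. Qed.

Lemma open_box_box q e : 0 < e -> open_box (box q e).
Proof.
move=> e0; exists `]q.1 - e, q.1 + e[%classic, `]q.2 - e, q.2 + e[%classic.
split; [|split] => //; split.
- exact: interval_open.
- exact: interval_is_interval.
- by exists q.1; rewrite /= in_itv /=; apply/andP; split; lra.
- exact: interval_open.
- exact: interval_is_interval.
- by exists q.2; rewrite /= in_itv /=; apply/andP; split; lra.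
Qed.

Lemma boxBall q e : box q e = ball q e.
Proof.
by apply/seteqP; split=> p;
  rewrite /ball /= /prod_ball -!ball_normE /box /= !in_itv /= !ltr_distl => -[/andP[? ?] /andP[? ?]]; split; apply/andP; split; lra.
Qed.

Lemma nbhs_boxP q (P : set (R * R)) :
  nbhs q P <-> exists2 e, 0 < e & box q e `<=` P.
Proof.
split.
  by move/nbhs_ballP => [e /= e0 H]; exists e => //; rewrite boxBall.
by move=> [e e0]; rewrite boxBall => H; apply/nbhs_ballP; exists e.
Qed.

Lemma open_box_open q e : open (box q e).
Proof.
rewrite openE => p /boxE [? ? ? ?]; apply/nbhs_boxP.
exists (Num.min (Num.min (p.1 - q.1 + e) (q.1 + e - p.1))
             (Num.min (p.2 - q.2 + e) (q.2 + e - p.2))).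
  by rewrite !lt_min; do !(apply/andP; split); lra.
move=> r /boxE; set m := Num.min _ _ => -[r1 r2 r3 r4].
have : m <= m by [].
rewrite {2}/m !le_min => /andP[/andP[? ?] /andP[? ?]].
by apply/boxE; split; lra.
Qed.

End Boxes.

(** * Gluing sheets into a foliated surface *)

(** The set [X], to be given the finest topology for which all the maps
    [psi i], restricted to [D i], are continuous. *)
Definition glued (R : realType) (X : choiceType) (I : Type)
  (D : I -> set (R * R)) (psi : I -> R * R -> X) : Type := X.

Section GluedTopology.
Context (R : realType) (X : choiceType) (I : Type).
Context (D : I -> set (R * R)) (psi : I -> R * R -> X).
Local Notation M := (glued D psi).

Definition glued_open (O : set M) : Prop :=
  forall i q, D i q -> O (psi i q) -> \forall p \near q, D i p -> O (psi i p).

Lemma glued_openT : glued_open setT.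
Proof. by move=> i q _ _; near=> p. Unshelve. all: by end_near. Qed.

Lemma glued_openI : setI_closed glued_open.
Proof.
move=> A A' oA oA' i q Dq [Aq A'q].
by apply: filterS2 (oA i q Dq Aq) (oA' i q Dq A'q) => p HA HA' Dp; split; auto.
Qed.

Lemma glued_open_bigU (J : Type) (f : J -> set M) :
  (forall j, glued_open (f j)) -> glued_open (\bigcup_j f j).
Proof.
move=> of_ i q Dq [j _ fjq].
by apply: filterS (of_ j i q Dq fjq) => p Hp Dp; exists j => //; apply: Hp.
Qed.

HB.instance Definition _ := Choice.on M.
HB.instance Definition _ :=
  isOpenTopological.Build M glued_openT glued_openI glued_open_bigU.

Lemma open_gluedE (O : set M) : open O = glued_open O.
Proof. by []. Qed.

End GluedTopology.

(** The shape of all the changes of coordinates below. *)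
Lemma cvg_skew (R : realType) (f : R * R -> R) (c : R) (q : R * R) :
  {for q, continuous f} ->
  (f p, p.2 + c) @[p --> q] --> (f q, q.2 + c).
Proof.
move=> fc; apply: (@cvg_pair _ _ _ (nbhs q) (nbhs (f q)) (nbhs (q.2 + c))) => //.
by apply: continuousD; [exact: cvg_snd | exact: cvg_cst].
Qed.

(** Near [q], the sheet [psi i] factors through [psi j] by a map which sends [q]
    to [q'] and is a translation in the transverse coordinate. The map need only be
    continuous at [q]: in [foliated_sheets] there is one for each point. *)
Definition sheet_change (R : realType) (X : choiceType) (I : Type)
    (D : I -> set (R * R)) (psi : I -> R * R -> X) (i j : I) (q q' : R * R) :=
  exists (f : R * R -> R) (c : R),
    [/\ {for q, continuous f}, q' = (f q, q.2 + c)
      & \forall p \near q, D i p ->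
          D j (f p, p.2 + c) /\ psi j (f p, p.2 + c) = psi i p].

(** The maps [psi i] need not be injective, only locally so: they are the
    local homeomorphisms, not the charts, of the surface to be built. *)
Definition foliated_sheets (R : realType) (X : choiceType) (I : Type)
    (D : I -> set (R * R)) (psi : I -> R * R -> X) : Prop :=
  [/\ forall i, open (D i),
      forall x, exists i q, D i q /\ psi i q = x,
      forall i j q q', D i q -> D j q' -> psi i q = psi j q' ->
        sheet_change D psi i j q q'
    & forall i q, D i q -> exists2 e, 0 < e &
        forall p p', box q e p -> box q e p' -> D i p -> D i p' ->
          psi i p = psi i p' -> p = p'].

Lemma sheet_change_trans (R : realType) (X : choiceType) (I : Type)
    (D : I -> set (R * R)) (psi : I -> R * R -> X) (i j k : I)
    (q q' q'' : R * R) :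
  sheet_change D psi i j q q' -> sheet_change D psi j k q' q'' ->
  sheet_change D psi i k q q''.
Proof.
move=> [f [c [fc q'E fP]]] [f' [c' [fc' q''E fP']]].
have tc := cvg_skew (c := c) fc; rewrite -q'E in tc.
exists (fun p => f' (f p, p.2 + c)), (c + c'); split.
- move: fc'; rewrite q'E => fc'; rewrite q'E in tc.
  exact: (cvg_comp _ _ tc fc').
- by rewrite q''E -q'E q'E /= addrA.
- have /= nP' := tc _ fP'.
  apply: filterS2 fP nP' => p Hp /= Hp' Dp.
  by have [D1 E1] := Hp Dp; rewrite addrA; have [D2 E2] := Hp' D1; rewrite E2.
Qed.

Section GluedSurface.
Context (R : realType) (X : choiceType) (I : Type).
Context (D : I -> set (R * R)) (psi : I -> R * R -> X).
Hypothesis sheets : foliated_sheets D psi.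
Local Notation M := (glued D psi).
Implicit Types (i j : I) (q p : R * R) (e : R).

Let open_D i : open (D i). Proof. by case: sheets. Qed.

Let near_D i q : D i q -> \forall p \near q, D i p.
Proof. by move=> Dq; apply: open_nbhs_nbhs. Qed.

(** Changes of coordinates towards [psi i] pull a neighbourhood of a point of
    [Q] back to a neighbourhood in any other sheet. *)
Lemma open_sheet i (Q : set (R * R)) :
  open Q -> Q `<=` D i -> open (psi i @` Q : set M).
Proof.
have [_ _ ch _] := sheets.
move=> oQ QD; rewrite open_gluedE => j q' Dq' [q Qq qq'].
have [f [c [fc qE fP]]] := ch j i q' q Dq' (QD _ Qq) (esym qq').
have tc := cvg_skew (c := c) fc; rewrite -qE in tc.
have /= nQ := tc _ (open_nbhs_nbhs (conj oQ Qq)).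
apply: filterS2 fP nQ => p Hp /= Qp Dp.
by exists (f p, p.2 + c) => //; have [] := Hp Dp.
Qed.

(** Each [psi i] is a local homeomorphism, so it carries the neighbourhoods
    of the plane to those of the surface. *)
Lemma nbhs_sheet i q (P : set M) : D i q ->
  nbhs (psi i q : M) P <-> \forall p \near q, P (psi i p).
Proof.
move=> Dq; split.
  rewrite nbhsE => -[A [oA Aq] AP].
  by apply: filterS2 (oA i q Dq Aq) (near_D Dq) => p Ap Dp; apply/AP/Ap.
move=> nP; have : \forall p \near q, P (psi i p) /\ D i p.
  by apply: filterS2 nP (near_D Dq) => p.
move/nbhs_boxP => [e e0 H].
rewrite nbhsE; exists (psi i @` box q e); last by move=> _ [p /H[? _] <-].
split; last by exists q => //; apply: boxq.
by apply: open_sheet; [exact: open_box_open | move=> p /H[]].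
Qed.

Definition sheet_chart i q e : chart R M :=
  (psi i @` box q e, fun x => xget q [set p | box q e p /\ psi i p = x]).

Definition small_box i q e : Prop :=
  [/\ 0 < e, box q e `<=` D i
    & forall p p', box q e p -> box q e p' -> psi i p = psi i p' -> p = p'].

Lemma small_boxW i q e e' : 0 < e' -> e' <= e -> small_box i q e ->
  small_box i q e'.
Proof.
move=> e'0 ee' [e0 bD inj]; split => //.
  by move=> p /(sub_box ee') /bD.
by move=> p p' /(sub_box ee') bp /(sub_box ee') bp'; apply: inj.
Qed.

Lemma small_boxP i q : D i q -> exists e, small_box i q e.
Proof.
have [_ _ _ inj] := sheets.
move=> Dq; have [e1 e10 H1] := inj i q Dq.
have /nbhs_boxP[e2 e20 H2] := near_D Dq.
exists (Num.min e1 e2).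
have b1 : box q (Num.min e1 e2) `<=` box q e1.
  by apply: sub_box; rewrite ge_min lexx.
have b2 : box q (Num.min e1 e2) `<=` D i.
  by move=> p bp; apply: H2; apply: sub_box bp; rewrite ge_min lexx orbT.
split=> //; first by rewrite lt_min e10.
by move=> p p' bp bp'; apply: H1; auto.
Qed.

Lemma sheet_chartK i q e p : small_box i q e -> box q e p ->
  (sheet_chart i q e).2 (psi i p) = p.
Proof.
move=> [_ _ inj] bp /=.
by case: xgetP => [p' _ [bp' /inj ->]//|/(_ p) []].
Qed.

Lemma sheet_chart_homeo i q e : small_box i q e ->
  homeo_on (sheet_chart i q e).1 (box q e) (sheet_chart i q e).2.
Proof.
move=> sb; have [e0 bD inj] := sb; split.
  have oc : open (sheet_chart i q e).1.
    by apply: open_sheet => //; exact: open_box_open.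
  rewrite continuous_open_subspace// => x /set_mem [p bp <-] P.
  rewrite (sheet_chartK sb bp) => nP.
  apply/(nbhs_sheet _ (bD _ bp)).
  have oP := open_nbhs_nbhs (conj (@open_box_open _ q e) bp).
  by apply: filterS2 nP oP => r Pr br; move: (sheet_chartK sb br) => /= ->.
exists (psi i); split.
- rewrite continuous_open_subspace; last exact: open_box_open.
  move=> p /set_mem bp P /= nP.
  exact/(nbhs_sheet _ (bD _ bp)).
- by move=> x [p bp <-]; move: (sheet_chartK sb bp) => /= ->.
- by move=> p bp; exists p.
- by move=> x /set_mem [p bp <-]; move: (sheet_chartK sb bp) => /= ->.
- by move=> p /set_mem bp; exact: (sheet_chartK sb bp).
Qed.

Lemma sheet_chart_foliated i q e : small_box i q e ->
  foliated_chart (sheet_chart i q e).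
Proof.
move=> sb; have [e0 bD _] := sb; split.
  by apply: open_sheet => //; exact: open_box_open.
exists (box q e); first exact: open_box_box.
exact: sheet_chart_homeo.
Qed.

Lemma sheet_chart_change i q e j q' e' :
  small_box i q e -> small_box j q' e' ->
  foliated_change (sheet_chart i q e) (sheet_chart j q' e').
Proof.
move=> sb sb' x [] [p bp <-] [p' bp' pp'].
have [e0 bD inj] := sb; have [e'0 bD' inj'] := sb'.
have [_ _ ch _] := sheets.
have [f [c [fc p'E fP]]] := ch i j p p' (bD _ bp) (bD' _ bp') (esym pp').
have tc := cvg_skew (c := c) fc; rewrite -p'E in tc.
exists f, (fun y => y + c).
apply/(nbhs_sheet _ (bD _ bp)).
have oP := open_nbhs_nbhs (conj (@open_box_open _ q e) bp).
have /= oP' := tc _ (open_nbhs_nbhs (conj (@open_box_open _ q' e') bp')).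
near=> r.
have br : box q e r by near: r.
have br' : box q' e' (f r, r.2 + c) by near: r.
have Dr := bD _ br.
have [_ rE] : D j (f r, r.2 + c) /\ psi j (f r, r.2 + c) = psi i r.
  by move: Dr; near: r.
have E' := sheet_chartK sb' br'; rewrite rE in E'.
by move: E' (sheet_chartK sb br) => /= -> ->.
Unshelve. all: by end_near. Qed.

Definition sheet_atlas : set (chart R M) :=
  [set c | exists i q e, small_box i q e /\ c = sheet_chart i q e].

Lemma sheet_atlasP : foliated_atlas sheet_atlas.
Proof.
have [_ cov _ _] := sheets.
split.
- by move=> _ [i [q [e [sb ->]]]]; apply: sheet_chart_foliated.
- move=> x; have [i [q [Dq <-]]] := cov x; have [e sb] := small_boxP Dq.
  exists (sheet_chart i q e); first by exists i, q, e.
  by exists q => //; apply: boxq; case: sb.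
- move=> _ _ [i [q [e [sb ->]]]] [j [q' [e' [sb' ->]]]].
  exact: sheet_chart_change.
Qed.

Definition sheet_foliation : set (chart R M) := saturation sheet_atlas.

Lemma sheet_foliationP : foliation sheet_foliation.
Proof. exact/saturation_foliation/sheet_atlasP. Qed.

Lemma locally_euclidean_glued (x : M) : exists U : set M, exists V : set (R * R),
  [/\ open U, U x, open V & homeomorphic U V].
Proof.
have [_ cov _ _] := sheets.
have [i [q [Dq <-]]] := cov x; have [e sb] := small_boxP Dq.
have [e0 bD _] := sb.
exists (psi i @` box q e), (box q e); split.
- by apply: open_sheet => //; exact: open_box_open.
- by exists q => //; apply: boxq.
- exact: open_box_open.
- by exists (sheet_chart i q e).2; apply: sheet_chart_homeo.
Qed.

End GluedSurface.
Arguments sheet_chart : simpl never.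

(** * Leaves of glued surfaces *)

Section LeafTopology.
Context (R : realType) (M : topologicalType) (F : set (chart R M)).

Lemma cvg_leaf_space (T : Type) (G : set_system T) (f : T -> leaf_space F)
    (x : leaf_space F) : Filter G ->
  (forall A, open_in_plaque F A -> A x -> G (f @^-1` A)) -> f @ G --> x.
Proof.
move=> FG H P; rewrite nbhsE => -[U [[E Esub <-] [V EV Vx]] UP].
have [C CF VE] := Esub _ EV; rewrite -VE in Vx.
have : G (f @^-1` V).
  rewrite -VE preimage_bigcap; apply: filter_bigI => A AC.
  by apply: H; [have := CF _ AC; rewrite inE | exact: Vx].
by apply: filterS => t Vt; apply: UP; exists V.
Qed.

Lemma open_plaque (A : set M) : open_in_plaque F A ->
  open (A : set (leaf_space F)).
Proof.
move=> FA; exists [set A]; last by rewrite bigcup_set1.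
move=> _ ->; exists (fset1 A); last by rewrite set_fset1 bigcap_set1.
by move=> B /fset1P ->; rewrite inE.
Qed.

End LeafTopology.

Section Lines.
Context (R : realType) (X : choiceType) (I : Type).
Context (D : I -> set (R * R)) (psi : I -> R * R -> X).
Hypothesis sheets : foliated_sheets D psi.
Local Notation M := (glued D psi).
Local Notation F := (@sheet_foliation R X I D psi).

Definition sheet_path (gam : R -> M) (s : R) : Prop :=
  exists i z, D i (s, z) /\ \forall s' \near s, gam s' = psi i (s', z).

Let cvg_slice (s z : R) : (s', z) @[s' --> s] --> (s, z).
Proof.
by apply: (@cvg_pair _ _ _ (nbhs s) (nbhs s) (nbhs z));
  [exact: cvg_id | exact: cvg_cst].
Qed.

(** A chart of the foliation differs from a sheet by a map that sends each
    plaque into a plaque, so a path which stays in a plaque of a sheet stays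
    locally in a plaque of every chart. *)
Lemma sheet_path_continuous (gam : R -> M) (s : R) : sheet_path gam s ->
  (gam : R -> leaf_space F) @ s --> (gam s : leaf_space F).
Proof.
move=> [i [z [Dsz gamE]]]; apply: cvg_leaf_space.
move=> _ [c [y [U [Fc oU ->]]]] [[c1 /= c2] Us].
have [e sb] := small_boxP sheets Dsz.
have [[oc _] /(_ (sheet_chart D psi i (s, z) e)) [|_ ch]] := Fc.
  by exists i, (s, z), e.
have gs : gam s = psi i (s, z) by apply: nbhs_singleton gamE.
have bq : box (s, z) e (s, z) by apply: boxq; case: sb.
have [|f [g cE]] := ch (gam s).
  by split => //; rewrite gs; exists (s, z).
have nc : nbhs (gam s) c.1 by apply: open_nbhs_nbhs.
have nU : nbhs (gam s) U by apply: open_nbhs_nbhs.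
have nb : nbhs (s, z) (box (s, z) e).
  by apply: open_nbhs_nbhs; split => //; exact: open_box_open.
have yE : y = g z.
  by rewrite -c2 (nbhs_singleton cE) gs (sheet_chartK sb bq).
rewrite gs in nc nU cE.
have /cvg_slice /= {}nc := (nbhs_sheet sheets _ Dsz).1 nc.
have /cvg_slice /= {}nU := (nbhs_sheet sheets _ Dsz).1 nU.
have /cvg_slice /= {}cE := (nbhs_sheet sheets _ Dsz).1 cE.
have /cvg_slice /= {}nb := nb.
suff : \forall s' \near s, (plaque c y `&` U) (gam s') by [].
near=> s'.
have gE : gam s' = psi i (s', z) by near: s'.
rewrite gE; split; last by near: s'.
split; first by near: s'.
rewrite /= yE.
have b' : box (s, z) e (s', z) by near: s'.
have -> : c.2 (psi i (s', z)) =
  (f ((sheet_chart D psi i (s, z) e).2 (psi i (s', z))),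
   g ((sheet_chart D psi i (s, z) e).2 (psi i (s', z))).2) by near: s'.
by rewrite (sheet_chartK sb b').
Unshelve. all: by end_near. Qed.

Lemma sheet_path_open (gam : R -> M) (s : R) (P : set R) : sheet_path gam s ->
  nbhs s P -> exists2 V : set (leaf_space F),
    open_nbhs (gam s : leaf_space F) V & V `<=` gam @` P.
Proof.
move=> [i [z [Dsz gamE]]] nP.
have gs : gam s = psi i (s, z) by apply: nbhs_singleton gamE.
have [e1 sb1] := small_boxP sheets Dsz.
have /nbhs_ballP [e2 /= e20 H2] : nbhs s (P `&` [set s' | gam s' = psi i (s', z)]).
  exact: filterI.
have e10 : 0 < e1 by case: sb1.
have sb : small_box D psi i (s, z) (Num.min e1 e2).
  by apply: small_boxW sb1; rewrite ?lt_min ?e10 // ge_min lexx.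
pose c := sheet_chart D psi i (s, z) (Num.min e1 e2).
have oc : open (plaque c z : set (leaf_space F)).
  apply: open_plaque; exists c, z, setT; split.
  - have [[Ac _ _] _] := sheet_foliationP sheets; split.
      exact: sheet_chart_foliated.
    move=> _ [j [q [e [sbj ->]]]].
    by split; exact: sheet_chart_change.
  - exact: openT.
  - by rewrite setIT.
have bq : box (s, z) (Num.min e1 e2) (s, z) by apply: boxq; case: sb.
have cs : plaque c z (gam s).
  by rewrite gs; split; [exists (s, z) | exact: (congr1 snd (sheet_chartK sb bq))].
exists (plaque c z); first exact: (conj oc cs).
move=> _ [[[s' z'] b <-]].
move=> zE; have zz : z' = z := etrans (esym (congr1 snd (sheet_chartK sb b))) zE.
subst z'.
have [|Ps' gs'] := H2 s'; last by exists s'.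
have le2 : Num.min e1 e2 <= e2 by rewrite ge_min lexx orbT.
have /boxE /= [h1 h2 _ _] := sub_box le2 b.
by rewrite -ball_normE /= distrC ltr_distl; apply/andP; split.
Qed.

(** The reparametrisation [rho], with continuous inverse [kap], is there for
    the lines whose natural parameter ranges over a half-line. *)
Definition sheet_line (L : set M) : Prop :=
  exists (gam : R -> M) (rho kap : R -> R),
    [/\ continuous rho,
        forall r, [/\ {for rho r, continuous kap}, kap (rho r) = r
                    & \forall s \near rho r, rho (kap s) = s],
        L = range (gam \o rho),
        forall r, sheet_path gam (rho r)
      & injective (gam \o rho)].

Lemma sheet_line_open (L : set M) : sheet_line L ->
  open (L : set (leaf_space F)).
Proof.
move=> [gam [rho [kap [crho krho -> path _]]]].
rewrite openE => _ [r _ <-] /=.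
have [ckap kr nk] := krho r.
have [V oV sV] := sheet_path_open (path r) nk.
rewrite /interior nbhsE; exists V => // x /sV [s sE <-].
by exists (kap s) => //=; rewrite sE.
Qed.

Lemma sheet_line_connected (L : set M) : sheet_line L ->
  connected (L : set (leaf_space F)).
Proof.
move=> [gam [rho [kap [crho krho -> path _]]]].
apply: (@connected_continuous_connected R (leaf_space F)).
  by apply/connected_intervalP.
rewrite continuous_open_subspace; last exact: openT.
move=> r _; apply: (@cvg_comp _ _ _ rho gam _ (nbhs (rho r))); first exact: crho.
exact: sheet_path_continuous.
Qed.

Lemma sheet_line_homeo (L : set M) : sheet_line L ->
  homeomorphic (L : set (leaf_space F)) [set: R].
Proof.
move=> Lline; have oL := sheet_line_open Lline.
have [gam [rho [kap [crho krho LE path inj]]]] := Lline.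
pose inv x := xget 0 [set r | gam (rho r) = x].
have invK r : inv (gam (rho r)) = r.
  by rewrite /inv; case: xgetP => [r' _ /inj //|/(_ r)/=].
exists inv; split.
  rewrite continuous_open_subspace // => x /set_mem; rewrite LE => -[r _ <-].
  move=> P /=; rewrite invK => nP.
  have [ckap kr nk] := krho r.
  have nkP : nbhs (rho r) (kap @^-1` P) by apply: ckap; rewrite kr.
  have [V oV sV] := sheet_path_open (path r) (filterI nk nkP).
  apply: filterS (open_nbhs_nbhs oV) => y /sV [s [sE Ps] <-].
  by rewrite -sE /= invK.
exists (gam \o rho); split.
- rewrite continuous_open_subspace; last exact: openT.
  move=> r _; apply: (@cvg_comp _ _ _ rho gam _ (nbhs (rho r))); first exact: crho.
  exact: sheet_path_continuous.
- by [].
- by move=> r _; rewrite LE; exists r.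
- by move=> x /set_mem; rewrite LE => -[r _ <-] /=; rewrite invK.
- by move=> r _ /=; rewrite invK.
Qed.

(** Each line is connected and open for the leaf topology; as the other lines
    cover its complement, it is also closed, hence a component. *)
Lemma leaf_sheet_line (LL : set (set M)) :
  (forall L, LL L -> sheet_line L) ->
  (forall x, exists2 L, LL L & L x) ->
  (forall L L' x, LL L -> LL L' -> L x -> L' x -> L = L') ->
  forall L x, LL L -> L x -> leaf F x = L.
Proof.
move=> line cov disj L x LL_L Lx; apply/seteqP; split; last first.
  apply: connected_component_max => //.
  exact/sheet_line_connected/line.
move=> y leafy; apply: contrapT => nLy.
set C := leaf F x in leafy.
have Cx : C x by exact: connected_component_refl.
have cC : connected C by exact: component_connected.
have CL : C `&` L = C.
  apply: (cC (C `&` L)); first by exists x.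
  - by exists L => //; exact/sheet_line_open/line.
  - exists L => //; rewrite -[L]setCK; apply: open_closedC.
    rewrite openE => z nLz.
    have [L' LL' L'z] := cov z.
    have oL' := sheet_line_open (line _ LL').
    apply: filterS (open_nbhs_nbhs (conj oL' L'z)) => w L'w Lw.
    by apply: nLz; rewrite (disj L L' w).
by apply: nLy; move: leafy; rewrite -CL => -[].
Qed.

End Lines.

(** * A rotation and a Cantor set meeting each of its orbits at most once *)

Section Arithmetic.
Context (R : realType).
Implicit Types (eps : nat -> bool) (n k : nat).

Definition tower n : nat := 2 ^ (2 ^ n).

Local Notation a n := ((tower n)%:R : R).

Lemma towerS n : a n.+1 = a n * a n.
Proof. by rewrite -natrM /tower expnS mul2n -addnn expnD. Qed.

Lemma tower_ge2 n : 2 <= a n.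
Proof. by rewrite ler_nat /tower -{1}(expn1 2) leq_exp2l // expn_gt0. Qed.

Lemma tower_gt n : n%:R < a n.
Proof.
rewrite ltr_nat; apply: leq_trans (ltn_expl (2 ^ n) (leqnn 2)).
exact: ltnW (ltn_expl n (leqnn 2)).
Qed.

Lemma tower_gt0 n : 0 < a n.
Proof. by have := tower_ge2 n; lra. Qed.

Definition partial_sum eps n : R := \sum_(0 <= j < n) (eps j)%:R / a j.

Lemma partial_sumS eps n :
  partial_sum eps n.+1 = partial_sum eps n + (eps n)%:R / a n.
Proof. by rewrite /partial_sum big_nat_recr. Qed.

Lemma partial_sum_tail eps n k :
  partial_sum eps n <= partial_sum eps (n + k) /\
  partial_sum eps (n + k) <= partial_sum eps n + 2 / a n - 2 / a (n + k).
Proof.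
elim: k => [|k [IH1 IH2]]; first by rewrite addn0; split; lra.
rewrite addnS partial_sumS towerS.
have a2 := tower_ge2 (n + k).
have i0 : 0 < (a (n + k))^-1 by rewrite invr_gt0; lra.
have i1 : 2 * ((a (n + k))^-1 * (a (n + k))^-1) <= (a (n + k))^-1.
  rewrite mulrA ger_pMl // -[_ <= 1]/(2 / a (n + k) <= 1).
  by rewrite ler_pdivrMr; lra.
have e0 : 0 <= (eps (n + k))%:R * (a (n + k))^-1 <= (a (n + k))^-1.
  by case: (eps _); rewrite ?mul1r ?mul0r; apply/andP; split; lra.
by rewrite invfM; split; lra.
Qed.

Lemma series_value eps : exists x : R, forall n,
  partial_sum eps n <= x <= partial_sum eps n + 2 / a n.
Proof.
have ub n m : partial_sum eps m <= partial_sum eps n + 2 / a n.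
  have p k : 0 < 2 / a k by rewrite divr_gt0 // tower_gt0.
  have [/subnKC <-|/ltnW/subnKC mn] := leqP n m.
    have [_] := partial_sum_tail eps n (m - n).
    by have := p (n + (m - n))%N; lra.
  have [h _] := partial_sum_tail eps m (n - m).
  by rewrite mn in h; have := p n; lra.
exists (sup (range (partial_sum eps))) => n.
have hs : has_sup (range (partial_sum eps)).
  split; first by exists (partial_sum eps 0), 0%N.
  by exists (partial_sum eps 0 + 2 / a 0) => _ [m _ <-].
apply/andP; split; first by apply: ub_le_sup; [exact: hs.2 | exists n].
by apply: ge_sup; [exact: hs.1 | move=> _ [m _ <-]].
Qed.

Definition lacunary_sum eps : R := projT1 (cid (series_value eps)).

Lemma lacunary_sumP eps n :
  partial_sum eps n <= lacunary_sum eps <= partial_sum eps n + 2 / a n.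
Proof. exact: (projT2 (cid (series_value eps))). Qed.

Lemma partial_sum_int eps n : exists m : int,
  a n * partial_sum eps n.+1 = m%:~R.
Proof.
elim: n => [|n [m IH]].
  exists (eps 0 : nat); rewrite partial_sumS /partial_sum big_nil add0r.
  by rewrite mulrCA divff ?mulr1// gt_eqF// tower_gt0.
exists (m * (tower n)%:Z + (eps n.+1 : nat)).
rewrite partial_sumS mulrDr mulrCA divff ?gt_eqF ?tower_gt0// mulr1 towerS.
by rewrite -mulrA IH intrD intrM mulrC !pmulrn.
Qed.

(** Multiplying by [a n] turns the first [n + 1] terms into an integer. What
    remains is dominated by its first term, of order [1 / a n] if the digit
    [n + 1] is present and at most of order [1 / a n ^ 3] otherwise. *)
Lemma frac_lacunary_sum eps n : exists m : int, exists2 r : R,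
  a n * lacunary_sum eps = m%:~R + r &
  if eps n.+1 then 1 / a n <= r <= 2 / a n else 0 <= r <= 2 / a n ^+ 3.
Proof.
have [m mE] := partial_sum_int eps n.
exists m, (a n * lacunary_sum eps - m%:~R); first by ring.
rewrite -mE -mulrBr.
have a0 := tower_gt0 n.
have /andP[h1 h1'] := lacunary_sumP eps n.+1.
have /andP[h2 h2'] := lacunary_sumP eps n.+2.
rewrite partial_sumS in h2 h2'.
rewrite (towerS n.+1) !towerS in h1' h2 h2'.
have cancelE c : a n * (c / (a n * a n)) = c / a n.
  by field; rewrite gt_eqF.
have cancelE' c : a n * (c / (a n * a n * (a n * a n))) = c / a n ^+ 3.
  by field; rewrite gt_eqF.
case: (eps n.+1) h2 h2' => /= h2 h2'.
  rewrite -!cancelE !ler_pM2l //; apply/andP; split; lra.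
rewrite -cancelE' ler_pM2l // pmulr_rge0 //; apply/andP; split; lra.
Qed.

Definition rot_angle : R := lacunary_sum odd.

(** A closed set, invariant under integer translations, which contains every
    lacunary sum all of whose digits are at even places. *)
Definition near_int_set : set R :=
  [set z | forall k, exists m : int, `|a k.*2 * z - m%:~R| <= 2 / a k.*2 ^+ 3].

(** A point outside lies strictly between two consecutive components. *)
Lemma closed_near_int (b e : R) :
  closed [set z | exists m : int, `|b * z - m%:~R| <= e].
Proof.
rewrite -[X in closed X]setCK; apply: open_closedC; rewrite openE => z /= nz.
pose m := Num.floor (b * z).
have m1 := floor_le (b * z); have m2 := floorD1_gt (b * z).
rewrite -/m in m1 m2.
have h1 : m%:~R + e < b * z.
  by rewrite ltNge; apply/negP => h; apply: nz; exists m; rewrite ger0_norm; lra.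
have h2 : b * z < (m + 1)%:~R - e.
  rewrite ltNge; apply/negP => h; apply: nz; exists (m + 1).
  by rewrite ler0_norm; lra.
have cb : b * y @[y --> z] --> b * z by apply: cvgM; [exact: cvg_cst|exact: cvg_id].
rewrite /interior; apply: filterS2 (cvgr_gt _ cb _ h1) (cvgr_lt _ cb _ h2).
move=> y y1 y2 /= [n]; rewrite ler_norml => /andP[n1 n2].
have [nm|nm] := leP n m.
  have : n%:~R <= m%:~R :> R by rewrite ler_int.
  lra.
have : (m + 1)%:~R <= n%:~R :> R by rewrite ler_int lezD1.
lra.
Qed.

Lemma closed_near_int_set : closed near_int_set.
Proof.
rewrite (_ : near_int_set = \bigcap_k
  [set z | exists m : int, `|a k.*2 * z - m%:~R| <= 2 / a k.*2 ^+ 3]).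
  by apply: closed_bigI => k _; exact: closed_near_int.
by apply/seteqP; split=> z h k => [_|]; apply: h.
Qed.

Lemma near_int_setDz z (n : int) :
  near_int_set z -> near_int_set (z + n%:~R).
Proof.
move=> Bz k; have [m mP] := Bz k; exists (m + n * (tower k.*2)%:Z).
rewrite intrD intrM -[((tower k.*2)%:Z)%:~R]/(a k.*2).
by have -> : a k.*2 * (z + n%:~R) - (m%:~R + n%:~R * a k.*2) =
  a k.*2 * z - m%:~R by ring.
Qed.

Lemma rot_angle_approx k : exists n : int,
  1 / a k.*2 <= a k.*2 * rot_angle - n%:~R <= 2 / a k.*2.
Proof.
have [n [r rE]] := frac_lacunary_sum odd k.*2.
rewrite /= odd_double /= => rP; exists n.
by rewrite /rot_angle rE addrAC subrr add0r.
Qed.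

Lemma small_int (m : int) : `|m%:~R| < 1 :> R -> m = 0.
Proof.
rewrite -intr_norm -[1]/(1%:~R) ltr_int => h.
by apply/eqP; rewrite -normr_le0 -ltzD1.
Qed.

Lemma tower_unbounded (c : R) : exists k, c < a k.*2.
Proof.
exists (Num.trunc c).+1; apply: lt_trans (truncnS_gt c) _.
apply: le_lt_trans (tower_gt _); rewrite ler_nat -addnn.
exact: leq_addr.
Qed.

(** Let [A = a (2 k)]. The difference of two points of the set, multiplied by
    [A], is within [4 / A ^ 3] of an integer. The angle, multiplied by [A], is
    an integer plus some [r] between [1 / A] and [2 / A]. For large [A] these
    numbers are so small that [m * r] itself must be at most [4 / A ^ 3], which
    is impossible unless [m = 0]. *)
Lemma near_int_set_orbit z (m : int) :
  near_int_set z -> near_int_set (z + m%:~R * rot_angle) -> m = 0.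
Proof.
move=> Bz Bm.
have [k ak] := tower_unbounded (4 * `|m%:~R| + 4).
have m0 := normr_ge0 (m%:~R : R).
have [n nP] := rot_angle_approx k.
have [n1 n1P] := Bz k; have [n2 n2P] := Bm k.
move: nP n1P n2P; set A := a k.*2 in ak *; set r := A * rot_angle - n%:~R.
move=> /andP[r1 r2] n1P n2P.
have A0 : 0 < A by lra.
pose N := n2 - n1 - m * n.
have mrN : `|m%:~R * r - N%:~R| <= 4 / A ^+ 3.
  rewrite (_ : m%:~R * r - N%:~R = (A * (z + m%:~R * rot_angle) - n2%:~R) -
      (A * z - n1%:~R)); last by rewrite /r /N !intrD !mulrNz intrM; ring.
  by apply: le_trans (ler_normB _ _) _; lra.
have A3 : 4 / A ^+ 3 <= 4 / A / 4.
  rewrite exprS invfM mulrA ler_pM2l ?divr_gt0 //.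
  rewrite lef_pV2 ?posrE ?exprn_gt0 // expr2; nra.
have A4 : 4 / A <= 1 by rewrite ler_pdivrMr; lra.
have mA : `|m%:~R| * (2 / A) <= 1 / 2.
  by rewrite mulrA ler_pdivrMr //; lra.
have r0 : 0 <= r by apply: le_trans r1; rewrite divr_ge0 // ltW.
have mr : `|m%:~R * r| <= 1 / 2.
  by rewrite normrM (ger0_norm r0); apply: le_trans mA; apply: ler_wpM2l.
have N0 : N = 0.
  apply: small_int; have -> : N%:~R = m%:~R * r - (m%:~R * r - N%:~R) by ring.
  by apply: le_lt_trans (ler_normB _ _) _; lra.
move: mrN; rewrite N0 subr0 normrM (ger0_norm r0) => mrN.
apply/eqP; apply: contraT => mn0.
have m1 : 1 <= `|m%:~R| :> R.
  by rewrite -intr_norm -[1]/(1%:~R) ler_int -gtz0_ge1 normr_gt0.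
have : 1 / A <= 4 / A ^+ 3.
  by apply: le_trans mrN; apply: le_trans r1 _; apply: ler_peMl.
rewrite ler_pdivlMr ?exprn_gt0 // (_ : 1 / A * A ^+ 3 = A * A); last first.
  by field; rewrite gt_eqF.
by nra.
Qed.

Lemma rot_angle_small_multiple (d : R) : 0 < d ->
  exists (q : nat) (n : int), (0 < q)%N /\ 0 < q%:R * rot_angle - n%:~R < d.
Proof.
move=> d0; have [k kd] := tower_unbounded (2 / d).
have [n /andP[n1 n2]] := rot_angle_approx k.
have a0 := tower_gt0 k.*2.
exists (tower k.*2), n; split; first by rewrite expn_gt0.
apply/andP; split; first by apply: lt_le_trans n1; rewrite divr_gt0.
by apply: le_lt_trans n2 _; rewrite ltr_pdivrMr // mulrC -ltr_pdivrMr.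
Qed.

(** The digits of [eps] at the even places, zeros at the odd ones. *)
Definition interleave0 eps n : bool := ~~ odd n && eps n./2.

Definition code eps : R := lacunary_sum (interleave0 eps).

Lemma near_int_set_code eps : near_int_set (code eps).
Proof.
move=> k; have [m [r rE]] := frac_lacunary_sum (interleave0 eps) k.*2.
rewrite /interleave0 /= odd_double /= => /andP[r0 r1].
by exists m; rewrite /code rE addrAC subrr add0r ger0_norm.
Qed.

Lemma code_lt1 eps : 0 <= code eps < 1.
Proof.
have /andP[h _] := lacunary_sumP (interleave0 eps) 0.
have /andP[_ h'] := lacunary_sumP (interleave0 eps) 2.
move: h h'; rewrite !partial_sumS /partial_sum big_nil /interleave0 /=.
rewrite add0r mul0r addr0 => h h'; rewrite h /=; apply: le_lt_trans h' _.
have -> : a 2 = 16 by rewrite !towerS /tower; ring.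
have -> : a 0 = 2 by [].
by case: (eps 0) => /=; lra.
Qed.

(** At the first digit where they differ, two codes are separated by more than
    all later digits can add up to. *)
Lemma code_inj eps eps' (n : int) :
  code eps - code eps' = n%:~R -> eps = eps'.
Proof.
move=> h; have n0 : n = 0.
  apply: small_int; rewrite -h.
  have /andP[? ?] := code_lt1 eps; have /andP[? ?] := code_lt1 eps'.
  by rewrite ltr_norml; apply/andP; split; lra.
have {h} E : code eps = code eps' by apply/eqP; rewrite -subr_eq0 h n0.
have step e e' k : code e = code e' ->
    partial_sum (interleave0 e) k.*2 = partial_sum (interleave0 e') k.*2 ->
    e k -> e' k.
  move=> ee' pE ek; apply: contraT => e'k.
  have /andP[h _] := lacunary_sumP (interleave0 e) k.*2.+1.
  have /andP[_ h'] := lacunary_sumP (interleave0 e') k.*2.+2.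
  move: h h'; rewrite !partial_sumS pE /interleave0 /= odd_double /= doubleK.
  rewrite ek (negbTE e'k) !towerS -/(code e) -/(code e') ee'.
  have := tower_ge2 k.*2; set A := a k.*2 => A2 h h'.
  have : 2 / (A * A * (A * A)) < 1 / A.
    rewrite ltr_pdivrMr; last by rewrite !mulr_gt0 //; lra.
    rewrite (_ : 1 / A * (A * A * (A * A)) = A * A * A); last first.
      by field; rewrite gt_eqF //; lra.
    have A4 : 4 <= A * A by nra.
    by nra.
  move: h h'; rewrite /= !mul0r !addr0; lra.
have main k : partial_sum (interleave0 eps) k.*2 =
    partial_sum (interleave0 eps') k.*2 /\ forall j, (j < k)%N -> eps j = eps' j.
  elim: k => [|k [pE IH]]; first by rewrite /partial_sum !big_nil.
  have ek : eps k = eps' k.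
    by apply/idP/idP; apply: step.
  split; last by move=> j; rewrite ltnS leq_eqVlt => /orP[/eqP ->|/IH].
  by rewrite doubleS !partial_sumS pE /interleave0 /= odd_double /= doubleK ek.
by apply/funext => k; have [_] := main k.+1; apply.
Qed.

End Arithmetic.

(** * Squeezing a ray next to its neighbours *)

Section Squash.
Context (R : realType).
Implicit Types (s t u : R).

(** For [s > 0], [squash s] maps the half-line homeomorphically onto the
    interval from 0 to 1, with inverse [stretch s]; as [s] tends to 0 it tends
    to [Num.min u 1]. With [s] the distance to a leaf that is continued by a
    ray, it compares the height [u] in the chart of that ray with the height in
    the torus: at [s = 0] the two agree for [u < 1], and the ray is [u >= 1]. *)
Definition squash s u : R := u / Num.max 1 (u + s).

Definition stretch s t : R := t * Num.max 1 (s / (1 - t)).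

Lemma squash_gt0 s u : 0 < u -> 0 < squash s u.
Proof. by move=> u0; rewrite divr_gt0 // lt_max ltr01. Qed.

Lemma squash_lt1 s u : 0 < u -> 0 <= s -> 0 < s \/ u < 1 -> squash s u < 1.
Proof.
move=> u0 s0 su; rewrite ltr_pdivrMr ?lt_max ?ltr01 // mul1r lt_max.
by case: su => [?|->//]; apply/orP; right; lra.
Qed.

Lemma squash0 u : u <= 1 -> squash 0 u = u.
Proof. by move=> u1; rewrite /squash addr0 max_l // divr1. Qed.

Lemma squash_ge_half s u : 0 <= s <= 1 / 2 -> 1 / 2 < u -> 1 / 2 <= squash s u.
Proof.
move=> /andP[s0 s1] u1; rewrite ler_pdivlMr ?lt_max ?ltr01 //.
by have [h|h] := leP (u + s) 1; lra.
Qed.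

Lemma stretch_gt0 s t : 0 < t -> 0 < stretch s t.
Proof. by move=> t0; rewrite mulr_gt0 // lt_max ltr01. Qed.

Lemma stretch0 t : stretch 0 t = t.
Proof. by rewrite /stretch mul0r max_l // mulr1. Qed.

Lemma squashK s u : 0 < u -> 0 <= s -> 0 < s \/ u < 1 ->
  stretch s (squash s u) = u.
Proof.
move=> u0 s0 su; rewrite /stretch /squash.
have [h|h] := leP (u + s) 1.
  rewrite divr1 max_l ?mulr1 //.
  case: su => [?|?]; first by rewrite ler_pdivrMr; lra.
  by rewrite ler_pdivrMr; lra.
have s1 : 0 < s by case: su => // ?; lra.
have -> : s / (1 - u / (u + s)) = u + s.
  by field; rewrite -?andbA; apply/andP; split; rewrite gt_eqF //; lra.
by rewrite max_r ?ltW // mulrVK // unitfE gt_eqF //; lra.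
Qed.

Lemma stretchK s t : 0 < t < 1 -> 0 <= s -> squash s (stretch s t) = t.
Proof.
move=> /andP[t0 t1] s0; rewrite /stretch /squash.
have d0 : 0 < 1 - t by lra.
have [h|h] := leP (s / (1 - t)) 1.
  rewrite mulr1 max_l ?divr1 //.
  by move: h; rewrite ler_pdivrMr; lra.
have -> : t * (s / (1 - t)) + s = s / (1 - t) by field; rewrite gt_eqF.
by rewrite max_r ?ltW // mulfK // gt_eqF //; lra.
Qed.

Lemma squash_continuous (T : topologicalType) (f g : T -> R) (x : T) :
  {for x, continuous f} -> {for x, continuous g} ->
  {for x, continuous (fun y => squash (f y) (g y))}.
Proof.
move=> cf cg; apply: cvgM => //; apply: cvgV.
  by rewrite gt_eqF // lt_max ltr01.
have c1 : {for x, continuous (fun=> 1 : R)} by exact: cvg_cst.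
have cgf : {for x, continuous (g \+ f)} by apply: cvgD.
exact: (continuous_max c1 cgf).
Qed.

Lemma stretch_continuous (T : topologicalType) (f g : T -> R) (x : T) :
  g x < 1 -> {for x, continuous f} -> {for x, continuous g} ->
  {for x, continuous (fun y => stretch (f y) (g y))}.
Proof.
move=> g1 cf cg; apply: cvgM => //.
have c1 : {for x, continuous (fun=> 1 : R)} by exact: cvg_cst.
have cfg : {for x, continuous (fun y => f y / (1 - g y))}.
  apply: cvgM => //; apply: cvgV; first by rewrite gt_eqF //; lra.
  by apply: cvgB => //; exact: cvg_cst.
exact: (continuous_max c1 cfg).
Qed.

End Squash.

(** * The blown-up torus *)

Section FracPart.
Context (R : realType).
Implicit Types x y : R.

Definition frac_part x : R := x - (Num.floor x)%:~R.

Lemma frac_part_itv x : 0 <= frac_part x < 1.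
Proof.
have := floor_le x; have := floorD1_gt x; rewrite intrD /frac_part => h h'.
by apply/andP; split; lra.
Qed.

Lemma frac_partD x (n : int) : frac_part (x + n%:~R) = frac_part x.
Proof. by rewrite /frac_part floorDrz ?rpred_int // intrKfloor intrD; ring. Qed.

Lemma frac_part_id x : 0 <= x < 1 -> frac_part x = x.
Proof.
move=> x01; rewrite /frac_part (_ : Num.floor x = 0) ?subr0 //.
by apply/eqP; rewrite floor_eq add0r.
Qed.

Lemma frac_part_eq x y : frac_part x = frac_part y ->
  exists n : int, y = x + n%:~R.
Proof.
move=> h; exists (Num.floor y - Num.floor x).
by move: h; rewrite /frac_part intrD mulrNz; lra.
Qed.

Lemma frac_partE x : exists n : int, x = frac_part x + n%:~R.
Proof. by exists (Num.floor x); rewrite /frac_part subrK. Qed.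

End FracPart.

(** The last condition implies, when [B] is nonempty, that [al] is irrational;
    see [generic_slit_irrational]. *)
Definition generic_slit (R : realType) (al : R) (B : set R) : Prop :=
  [/\ closed B, forall z (n : int), B z -> B (z + n%:~R)
    & forall z (m : int), B z -> B (z + m%:~R * al) -> m = 0].

Section BlownTorus.
Context (R : realType) (al : R) (B : set R).
Hypothesis slitB : generic_slit al B.
Implicit Types (q : R * R) (m n : int).

(** The coordinates [(t, x)] of a canonical representative. Those with [t < 1]
    are the points of the torus cut along the circle [t = 0], with the
    points of [B] on that circle removed; those with [1 <= t] are the points
    of the rays, [(1 + s, x)] being at height [s] on the ray of [x]. *)
Definition blown_coord : set (R * R) :=
  [set p | [/\ 0 <= p.1, 0 <= p.2 < 1, p.1 = 0 -> ~ B p.2 & 1 <= p.1 -> B p.2]].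

Definition blown_torus : Type := set_type blown_coord.

HB.instance Definition _ := Choice.on blown_torus.

Lemma blown_coord0 : (1 / 2, 0) \in blown_coord.
Proof. by apply/mem_set; split=> /=; rewrite ?ltr01 ?lexx //; lra. Qed.

Definition blown_pt (p : R * R) : blown_torus :=
  if pselect (blown_coord p) is left pc
  then exist (fun p => p \in blown_coord) p (mem_set pc)
  else exist (fun p => p \in blown_coord) _ blown_coord0.

Lemma val_blown_pt p : blown_coord p -> sval (blown_pt p) = p.
Proof. by rewrite /blown_pt; case: pselect. Qed.

Lemma blown_ptK (x : blown_torus) : blown_pt (sval x) = x.
Proof.
case: x => p pc; rewrite /blown_pt /=.
case: pselect => [h|]; last by case; apply: set_mem.
by congr exist; exact: bool_irrelevance.
Qed.

(** The points of the plane which the covering [torus_pt] of the torus does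
    not send to a removed point. *)
Definition unslit q : Prop := forall m, q.1 = m%:~R -> ~ B (q.2 + m%:~R * al).

(** The covering of the torus by the plane, in which the leaves are the lines
    with constant second coordinate. It is invariant under the lattice spanned
    by [(1, - al)] and [(0, 1)]. *)
Definition torus_pt q : blown_torus :=
  blown_pt (frac_part q.1, frac_part (q.2 + (Num.floor q.1)%:~R * al)).

(** The point at height [q.1] on the ray attached to [q.2]. *)
Definition ray_pt q : blown_torus := blown_pt (1 + q.1, frac_part q.2).

Let Bn z n : B z -> B (z + n%:~R). Proof. by case: slitB => _ + _; apply. Qed.

Lemma slit_frac_part z : B (frac_part z) <-> B z.
Proof.
split=> [Bf|Bz]; last by rewrite /frac_part -mulrNz; apply: Bn.
by have [n ->] := frac_partE z; apply: Bn.
Qed.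

Lemma unslit_shift q m n : unslit q ->
  unslit (q.1 + m%:~R, q.2 - m%:~R * al + n%:~R).
Proof.
move=> gq k /= kE Bk; apply: (gq (k - m)).
  by rewrite intrD mulrNz -kE; ring.
have -> : q.2 + (k - m)%:~R * al =
  q.2 - m%:~R * al + n%:~R + k%:~R * al + (- n)%:~R.
  by rewrite intrD !mulrNz; ring.
exact: Bn.
Qed.

Lemma unslit_open_strip q m : m%:~R < q.1 < (m + 1)%:~R -> unslit q.
Proof.
move=> /andP[h1 h2] k kE; move: h1 h2; rewrite kE !ltr_int.
by rewrite ltzD1 => h1 h2; move: (lt_le_trans h1 h2); rewrite ltxx.
Qed.

Lemma torus_pt_coord q : unslit q ->
  blown_coord (frac_part q.1, frac_part (q.2 + (Num.floor q.1)%:~R * al)).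
Proof.
move=> gq; have /andP[h1 h2] := frac_part_itv q.1.
split=> //=; first exact: frac_part_itv.
  move=> h /slit_frac_part; apply: gq.
  by move: h; rewrite /frac_part => /eqP; rewrite subr_eq0 => /eqP.
by move=> h; lra.
Qed.

Lemma ray_pt_coord q : B q.2 -> 0 <= q.1 -> blown_coord (1 + q.1, frac_part q.2).
Proof.
move=> Bq q0; split=> /=; first lra.
- exact: frac_part_itv.
- by move=> ?; lra.
- by move=> _; apply/slit_frac_part.
Qed.

Lemma torus_pt_shift q m n :
  torus_pt (q.1 + m%:~R, q.2 - m%:~R * al + n%:~R) = torus_pt q.
Proof.
rewrite /torus_pt /= frac_partD; congr (blown_pt (_, _)).
rewrite floorDrz ?rpred_int // intrKfloor intrD.
by rewrite -[RHS](@frac_partD _ _ n); congr frac_part; ring.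
Qed.

Lemma torus_pt_inj q q' : unslit q -> unslit q' -> torus_pt q = torus_pt q' ->
  exists m n, q' = (q.1 + m%:~R, q.2 - m%:~R * al + n%:~R).
Proof.
move=> gq gq' /(congr1 sval).
rewrite !val_blown_pt; try exact: torus_pt_coord.
move=> [h1 /frac_part_eq [n hn]].
exists (Num.floor q'.1 - Num.floor q.1), n.
rewrite [q']surjective_pairing; congr (_, _); rewrite intrD mulrNz.
  by move: h1; rewrite /frac_part; lra.
have -> : q'.2 = q'.2 + (Num.floor q'.1)%:~R * al - (Num.floor q'.1)%:~R * al.
  by ring.
by rewrite hn; ring.
Qed.

Lemma ray_pt_shift q n : ray_pt (q.1, q.2 + n%:~R) = ray_pt q.
Proof. by rewrite /ray_pt /= frac_partD. Qed.

Lemma ray_pt_inj q q' : B q.2 -> 0 <= q.1 -> B q'.2 -> 0 <= q'.1 ->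
  ray_pt q = ray_pt q' -> exists n, q' = (q.1, q.2 + n%:~R).
Proof.
move=> Bq q0 Bq' q0' /(congr1 sval).
rewrite !val_blown_pt; try exact: ray_pt_coord.
move=> [h1 /frac_part_eq [n hn]]; exists n.
by rewrite [q']surjective_pairing hn; congr (_, _); lra.
Qed.

Lemma torus_pt_neq_ray_pt q q' : unslit q -> B q'.2 -> 0 <= q'.1 ->
  torus_pt q <> ray_pt q'.
Proof.
move=> gq Bq' q'0 /(congr1 sval).
rewrite (val_blown_pt (torus_pt_coord gq)) (val_blown_pt (ray_pt_coord Bq' q'0)).
by move=> [h _]; have /andP[_] := frac_part_itv q.1; lra.
Qed.

Lemma blown_torus_cover (x : blown_torus) :
  (exists2 q, unslit q & x = torus_pt q) \/
  (exists q, [/\ B q.2, 0 <= q.1 & x = ray_pt q]).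
Proof.
have [p1 p2 p3 p4] : blown_coord (sval x) by apply: set_mem; exact: (svalP x).
have xE := esym (blown_ptK x).
have [h|h] := ltP (sval x).1 1; last first.
  right; exists ((sval x).1 - 1, (sval x).2); split=> /=; [exact: p4|lra|].
  rewrite /ray_pt /= frac_part_id // [LHS]xE; congr blown_pt.
  by rewrite [LHS]surjective_pairing; congr (_, _); ring.
have f0 : Num.floor (sval x).1 = 0 by apply/eqP; rewrite floor_eq add0r p1.
left; exists (sval x).
  move=> m mE; have m0 : m = 0 by rewrite -f0 mE intrKfloor.
  by rewrite m0 mul0r addr0; apply: p3; rewrite mE m0.
rewrite /torus_pt f0 mul0r addr0 !frac_part_id ?p1 //.
by rewrite -surjective_pairing.
Qed.

Lemma open_unslit : open unslit.
Proof.
have [cB _ _] := slitB.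
rewrite openE => q gq; rewrite /interior.
pose m := Num.floor q.1.
have m1 : (m - 1)%:~R < q.1.
  by rewrite intrD mulrNz; have := floor_le q.1; rewrite -/m; lra.
have m2 : q.1 < (m + 1)%:~R := floorD1_gt q.1.
have cfst : p.1 @[p --> q] --> q.1 by exact: cvg_fst.
have n1 : \forall p \near q, (m - 1)%:~R < p.1 by apply: (cvgr_gt _ cfst).
have n2 : \forall p \near q, p.1 < (m + 1)%:~R by apply: (cvgr_lt _ cfst).
have n3 : \forall p \near q, p.1 = m%:~R -> ~ B (p.2 + m%:~R * al).
  have [qm|qm] := eqVneq q.1 m%:~R.
    have : \forall p \near q, (~` B) (p.2 + m%:~R * al).
      have cadd : p.2 + m%:~R * al @[p --> q] --> q.2 + m%:~R * al.
        by apply: cvgD; [exact: cvg_snd | exact: cvg_cst].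
      apply: cadd; apply: open_nbhs_nbhs; split; first exact: closed_openC.
      exact: gq.
    by apply: filterS => p h _.
  have mq : m%:~R < q.1 by rewrite lt_neqAle eq_sym qm floor_le.
  by apply: filterS (cvgr_gt _ cfst _ mq) => p h pE; move: h; rewrite pE ltxx.
suff : \forall p \near q, unslit p by [].
near=> p.
have p1 : (m - 1)%:~R < p.1 by near: p.
have p2 : p.1 < (m + 1)%:~R by near: p.
have p3 : p.1 = m%:~R -> ~ B (p.2 + m%:~R * al) by near: p.
move=> k kE.
have km : k = m by move: p1 p2; rewrite kE !ltr_int; lia.
by rewrite km; apply: p3; rewrite kE km.
Unshelve. all: by end_near. Qed.

End BlownTorus.

(** * An atlas of the blown-up torus *)

Section Sheets.
Context (R : realType) (al : R) (B : set R).
Hypothesis slitB : generic_slit al B.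
Implicit Types (q p : R * R) (y : R) (i j : option R).
Local Notation X := (blown_torus B).
Local Notation torus_pt := (@torus_pt R al B).
Local Notation ray_pt := (@ray_pt R B).
Local Notation unslit := (@unslit R al B).

Definition sheet_dom i : set (R * R) :=
  if i is Some y then [set q | B y /\ -1 < q.1] else [set q | unslit q].

Definition off_ray y q : Prop := q.1 < 0 \/ q.2 <> y.

(** In the sheet of [y], heights are counted from the circle, so that the ray
    starts at 0 and the piece of the torus below it at -1. *)
Definition press y q : R := squash `|q.2 - y| (q.1 + 1) - 1.

Definition unpress y q : R := stretch `|q.2 - y| (q.1 + 1) - 1.

(** The sheet [None] is the covering of the torus; the sheet [Some y] consists
    of the ray of [y] and of the part of the torus in [-1 < s < 0], with
    the heights stretched so that every leaf other than that of [y] occupies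
    the whole half-line [-1 < s] without reaching the circle. *)
Definition sheet i q : X :=
  if i is Some y then
    if pselect (off_ray y q) then torus_pt (press y q, q.2) else ray_pt q
  else torus_pt q.

Lemma sheet_off y q : off_ray y q -> sheet (Some y) q = torus_pt (press y q, q.2).
Proof. by rewrite /=; case: pselect. Qed.

Lemma sheet_on y q : ~ off_ray y q -> sheet (Some y) q = ray_pt q.
Proof. by rewrite /=; case: pselect. Qed.

Lemma not_off_ray y q : ~ off_ray y q -> 0 <= q.1 /\ q.2 = y.
Proof.
move=> h; split; first by rewrite leNgt; apply/negP => h'; apply: h; left.
by apply: contrapT => h'; apply: h; right.
Qed.

Let off_rayP y q : off_ray y q -> 0 < `|q.2 - y| \/ q.1 + 1 < 1.
Proof.
case=> h; first by right; lra.
by left; rewrite normr_gt0 subr_eq0; apply/eqP.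
Qed.

Lemma press_itv y q : -1 < q.1 -> off_ray y q -> -1 < press y q < 0.
Proof.
move=> q1 /off_rayP h; have q0 : 0 < q.1 + 1 by lra.
have h1 := squash_gt0 `|q.2 - y| q0.
have h2 := squash_lt1 q0 (normr_ge0 _) h.
by rewrite /press; apply/andP; split; lra.
Qed.

Lemma pressK y q : -1 < q.1 -> off_ray y q -> unpress y (press y q, q.2) = q.1.
Proof.
move=> q1 /off_rayP h; rewrite /press /unpress /= subrK squashK //; last lra.
by rewrite addrK.
Qed.

Lemma unpressK y q : -1 < q.1 < 0 -> press y (unpress y q, q.2) = q.1.
Proof.
move=> q1; rewrite /press /unpress /= subrK stretchK //; last lra.
by rewrite addrK.
Qed.

Lemma unpress_gt y q : -1 < q.1 -> -1 < unpress y q.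
Proof.
move=> q1; have q0 : 0 < q.1 + 1 by lra.
by have := stretch_gt0 `|q.2 - y| q0; rewrite /unpress; lra.
Qed.

Lemma off_ray_unpress y q : q.1 < 0 -> off_ray y (unpress y q, q.2).
Proof.
move=> q0; rewrite /off_ray /unpress /=.
have [->|/eqP] := eqVneq q.2 y; last by right.
by rewrite subrr normr0 stretch0 addrK; left.
Qed.

Let dist_continuous y q : {for q, continuous (fun p => `|p.2 - y|)}.
Proof.
by apply: cvg_norm; apply: cvgB; [exact: cvg_snd | exact: cvg_cst].
Qed.

Let succ_continuous q : {for q, continuous (fun p => p.1 + 1)}.
Proof. by apply: cvgD; [exact: cvg_fst | exact: cvg_cst]. Qed.

Lemma press_continuous y q : {for q, continuous (press y)}.
Proof.
apply: cvgB; last exact: cvg_cst.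
exact: (squash_continuous (@dist_continuous y q) (@succ_continuous q)).
Qed.

Lemma unpress_continuous y q : q.1 < 0 -> {for q, continuous (unpress y)}.
Proof.
move=> q0; apply: cvgB; last exact: cvg_cst.
have q1 : q.1 + 1 < 1 by lra.
apply: (@stretch_continuous _ _ _ (fun p => p.1 + 1) q q1).
exact: @dist_continuous.
exact: @succ_continuous.
Qed.

Lemma near_off_ray y q : off_ray y q -> \forall p \near q, off_ray y p.
Proof.
have cfst : p.1 @[p --> q] --> q.1 by exact: cvg_fst.
case=> h; first by apply: filterS (cvgr_lt _ cfst _ h); left.
have h' : 0 < `|q.2 - y| by rewrite normr_gt0 subr_eq0; apply/eqP.
apply: filterS (cvgr_gt _ (@dist_continuous y q) _ h') => p; right => py.
by move: H; rewrite py subrr normr0 ltxx.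
Qed.

Lemma unslit_press y q z : -1 < q.1 -> off_ray y q -> unslit (press y q, z).
Proof.
by move=> q1 oq; apply: (@unslit_open_strip _ _ _ _ (-1)); exact: press_itv.
Qed.

Lemma open_sheet_dom i : open (sheet_dom i).
Proof.
case: i => [y|] /=; last exact: open_unslit.
have [By|nBy] := pselect (B y).
  rewrite (_ : [set _ | _] = fst @^-1` `]-1, +oo[); last first.
    by apply/seteqP; split=> q /=; rewrite in_itv /= andbT // => -[].
  apply: open_comp; last exact: interval_open.
  by move=> q _; exact: cvg_fst.
rewrite (_ : [set _ | _] = set0); first exact: open0.
by apply/seteqP; split=> q // [].
Qed.

Lemma sheet_cover (x : X) : exists i q, sheet_dom i q /\ sheet i q = x.
Proof.
have [[q uq ->]|[q [Bq q0 ->]]] := blown_torus_cover al x.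
  by exists None, q.
exists (Some q.2), q; split; first by split => //; lra.
by rewrite sheet_on // => -[|//]; lra.
Qed.

Lemma torus_change q q' : unslit q -> unslit q' -> torus_pt q = torus_pt q' ->
  sheet_change sheet_dom sheet None None q q'.
Proof.
move=> uq uq' /(torus_pt_inj slitB uq uq') [m [n qE]].
exists (fun p => p.1 + m%:~R), (- m%:~R * al + n%:~R); split.
- by apply: cvgD; [exact: cvg_fst | exact: cvg_cst].
- by rewrite qE; congr (_, _); ring.
- near=> p => up /=.
  have -> : p.2 + (- m%:~R * al + n%:~R) = p.2 - m%:~R * al + n%:~R by ring.
  by split; [exact: unslit_shift | exact: torus_pt_shift].
Unshelve. all: by end_near. Qed.

Lemma press_change y q : sheet_dom (Some y) q -> off_ray y q ->
  sheet_change sheet_dom sheet (Some y) None q (press y q, q.2).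
Proof.
move=> [By q1] oq; exists (press y), 0; split.
- exact: press_continuous.
- by rewrite addr0.
- apply: filterS (near_off_ray oq) => p op [_ p1]; rewrite addr0.
  by split; [exact: unslit_press | rewrite sheet_off].
Qed.

Lemma unpress_change y q : B y -> -1 < q.1 < 0 ->
  sheet_change sheet_dom sheet None (Some y) q (unpress y q, q.2).
Proof.
move=> By /andP[q1 q0]; exists (unpress y), 0; split.
- exact: unpress_continuous.
- by rewrite addr0.
- have cfst : p.1 @[p --> q] --> q.1 by exact: cvg_fst.
  apply: filterS2 (cvgr_gt _ cfst _ q1) (cvgr_lt _ cfst _ q0) => p p1 p0 up.
  rewrite addr0; split; first by split => //; exact: unpress_gt.
  by rewrite (sheet_off (off_ray_unpress y p0)) unpressK ?p1 // -surjective_pairing.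
Qed.

Lemma ray_change y q (n : int) : sheet_dom (Some y) q ->
  sheet_change sheet_dom sheet (Some y) (Some (y + n%:~R)) q (q.1, q.2 + n%:~R).
Proof.
have [_ Bn _] := slitB.
move=> [By q1]; exists fst, n%:~R; split => //; first exact: cvg_fst.
near=> p => -[_ p1]; split; first by split => //; exact: Bn.
have pE : press (y + n%:~R) (p.1, p.2 + n%:~R) = press y p.
  by rewrite /press /=; congr (squash `|_| _ - _); ring.
have [op|nop] := pselect (off_ray y p).
  have op' : off_ray (y + n%:~R) (p.1, p.2 + n%:~R).
    by case: op => h; [left | right => /addIr].
  rewrite !sheet_off // pE.
  have := @torus_pt_shift R al B (press y p, p.2) 0 n.
  by rewrite /= addr0 mul0r subr0.
rewrite !sheet_on ?ray_pt_shift // => op'; apply: nop.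
by case: op' => h; [left | right => h'; apply: h; rewrite /= h'].
Unshelve. all: by end_near. Qed.

(** Away from the rays all sheets factor through [None], where the coincidences
    are lattice translations. A point on a ray belongs only to the sheets of
    the translates of that ray by integers. *)
Lemma sheet_changeP i j q q' : sheet_dom i q -> sheet_dom j q' ->
  sheet i q = sheet j q' -> sheet_change sheet_dom sheet i j q q'.
Proof.
(* off the rays, a sheet is interchangeable with the covering of the torus *)
have to_torus k p : sheet_dom k p -> (if k is Some y then off_ray y p else True) ->
    exists p', [/\ unslit p', sheet k p = torus_pt p',
      sheet_change sheet_dom sheet k None p p' &
      sheet_change sheet_dom sheet None k p' p].
  case: k => [y|] /= dp op; last first.
    by exists p; split => //; apply: torus_change.
  have [By p1] := dp.
  exists (press y p, p.2); split.
  - exact: unslit_press.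
  - exact: (sheet_off op).
  - exact: press_change.
  - rewrite [X in sheet_change _ _ _ _ _ X]surjective_pairing -(pressK p1 op).
    exact: (@unpress_change y (press y p, p.2) By (press_itv p1 op)).
have not_torus k p : ~ (if k is Some y then off_ray y p else True) ->
    sheet_dom k p -> exists2 y, k = Some y & [/\ B y, 0 <= p.1 & p.2 = y].
  by case: k => [y|//] /not_off_ray [? ?] [By _]; exists y.
move=> dq dq' qq'.
have [oq|/not_torus h] := pselect (if i is Some y then off_ray y q else True);
have [oq'|/not_torus h'] := pselect (if j is Some y then off_ray y q' else True).
- have [p [up pE c1 _]] := to_torus _ _ dq oq.
  have [p' [up' pE' _ c2]] := to_torus _ _ dq' oq'.
  apply: sheet_change_trans c1 _; apply: sheet_change_trans c2.
  by apply: torus_change => //; rewrite -pE -pE'.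
- have [p [up pE _ _]] := to_torus _ _ dq oq.
  have [y jE [By q'0 q'y]] := h' dq'; subst j y.
  move: qq'; rewrite pE sheet_on.
    by move/(torus_pt_neq_ray_pt slitB up By q'0).
  by case=> [|//]; lra.
- have [p [up pE _ _]] := to_torus _ _ dq' oq'.
  have [y iE [By q0 qy]] := h dq; subst i y.
  move: qq'; rewrite pE sheet_on.
    by move/esym/(torus_pt_neq_ray_pt slitB up By q0).
  by case=> [|//]; lra.
- have [y iE [By q0 qy]] := h dq; have [y' jE [By' q'0 q'y]] := h' dq'.
  subst i j y y'; move: qq'; rewrite !sheet_on; try by case=> [|//]; lra.
  move=> /(ray_pt_inj slitB By q0 By' q'0) [n q'E].
  by rewrite q'E /=; apply: ray_change.
Qed.

Lemma sheet_some_inj y p p' : sheet_dom (Some y) p -> sheet_dom (Some y) p' ->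
  `|p'.2 - p.2| < 1 -> sheet (Some y) p = sheet (Some y) p' -> p = p'.
Proof.
move=> [By p1] [_ p'1] d2.
have same n : p'.2 = p.2 + n%:~R -> p'.2 = p.2.
  move=> pE; have n0 : n = 0.
    by apply: (@small_int R); move: d2; rewrite pE addrAC subrr add0r.
  by rewrite pE n0 addr0.
have [op|/[dup] nop /not_off_ray [p0 py]] := pselect (off_ray y p);
have [op'|/[dup] nop' /not_off_ray [p'0 p'y]] := pselect (off_ray y p').
- rewrite !sheet_off // => /(torus_pt_inj slitB _ _)[||m [n [pE1 pE2]]].
  + exact: unslit_press.
  + exact: unslit_press.
  have /andP[h1 h2] := press_itv p1 op; have /andP[h1' h2'] := press_itv p'1 op'.
  have m0 : m = 0.
    by apply: (@small_int R); rewrite ltr_norml; apply/andP; split; lra.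
  move: pE1 pE2; rewrite m0 mul0r subr0 addr0 => pE1 /same pE2.
  rewrite [p]surjective_pairing [p']surjective_pairing.
  by rewrite -(pressK p1 op) -(pressK p'1 op') pE1 pE2.
- rewrite sheet_off // sheet_on // => /(torus_pt_neq_ray_pt slitB).
  by case=> //; [exact: unslit_press | rewrite p'y].
- rewrite sheet_on // sheet_off // => /esym/(torus_pt_neq_ray_pt slitB).
  by case=> //; [exact: unslit_press | rewrite py].
- rewrite !sheet_on // => /(ray_pt_inj slitB _ p0 _ p'0) []; rewrite ?py ?p'y //.
  move=> n pE; rewrite [p]surjective_pairing [p']surjective_pairing py p'y.
  by rewrite pE.
Qed.

Lemma sheet_inj i q : sheet_dom i q -> exists2 e, 0 < e &
  forall p p', box q e p -> box q e p' -> sheet_dom i p -> sheet_dom i p' ->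
    sheet i p = sheet i p' -> p = p'.
Proof.
move=> _; exists (1 / 2); first lra.
move=> p p' /boxE[b1 b2 b3 b4] /boxE[b1' b2' b3' b4'].
have d1 : `|p'.1 - p.1| < 1 by rewrite ltr_norml; apply/andP; split; lra.
have d2 : `|p'.2 - p.2| < 1 by rewrite ltr_norml; apply/andP; split; lra.
case: i => [y|] dp dp'; first exact: sheet_some_inj.
move=> /(torus_pt_inj slitB dp dp') [m [n pE]].
have m0 : m = 0.
  by apply: (@small_int R); move: d1; rewrite pE /= addrAC subrr add0r.
have n0 : n = 0.
  apply: (@small_int R); move: d2.
  by rewrite pE m0 mul0r subr0 /= addrAC subrr add0r.
by rewrite pE m0 n0 mul0r subr0 !addr0 -surjective_pairing.
Qed.

Theorem blown_sheets : foliated_sheets sheet_dom sheet.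
Proof.
split; [exact: open_sheet_dom | exact: sheet_cover | exact: sheet_changeP |].
exact: sheet_inj.
Qed.

End Sheets.

(** * Leaves of the blown-up torus *)

Lemma near_lt (R : realType) (s c : R) : s < c -> \forall t \near s, t < c.
Proof.
have ids : t @[t --> s] --> s by exact: cvg_id.
by move=> sc; apply: (cvgr_lt _ ids).
Qed.

Lemma near_gt (R : realType) (s c : R) : c < s -> \forall t \near s, c < t.
Proof.
have ids : t @[t --> s] --> s by exact: cvg_id.
by move=> sc; apply: (cvgr_gt _ ids).
Qed.

Definition blown_surface (R : realType) (al : R) (B : set R) : topologicalType :=
  glued (@sheet_dom R al B) (@sheet R al B).

Section LeavesOfBlownTorus.
Context (R : realType) (al : R) (B : set R).
Hypothesis slitB : generic_slit al B.
Hypothesis B_neq0 : B !=set0.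
Implicit Types (q p : R * R) (s y z : R) (m n : int).
Local Notation M := (blown_surface al B).
Local Notation torus_pt := (@torus_pt R al B).
Local Notation ray_pt := (@ray_pt R B).
Local Notation unslit := (@unslit R al B).
Local Notation sheet := (@sheet R al B).
Local Notation sheet_dom := (@sheet_dom R al B).

Definition blown_foliation : set (chart R M) :=
  @sheet_foliation R (blown_torus B) (option R) sheet_dom sheet.

Let sheets := blown_sheets slitB.

Let torus_neq_ray q s y : unslit q -> B y -> 0 <= s -> torus_pt q <> ray_pt (s, y).
Proof. by move=> uq By s0; apply: (torus_pt_neq_ray_pt slitB). Qed.

(** The lattice translations that preserve [B] at a point of [B] are the
    integer transverse ones: this is what keeps the pieces of a cut leaf
    apart. *)
Lemma slit_orbit_eq y y' m n : B y -> B y' ->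
  y' = y - m%:~R * al + n%:~R -> m = 0.
Proof.
have [_ Bn Bm] := slitB.
move=> By By' y'E; apply/oppr_inj; rewrite oppr0; apply: (Bm y) => //.
have -> : y + (- m)%:~R * al = y' + (- n)%:~R by rewrite y'E !mulrNz; ring.
exact: Bn.
Qed.

Lemma generic_slit_irrational m n : m%:~R * al = n%:~R -> m = 0.
Proof.
have [_ Bn Bm] := slitB; have [y By] := B_neq0.
by move=> mn; apply: (Bm y) => //; rewrite mn; apply: Bn.
Qed.

Lemma unslit_on_slit s y : B y -> s != 0 -> unslit (s, y).
Proof.
have [_ _ Bm] := slitB.
move=> By s0 m /= sE Bym; move/eqP: s0; apply.
by rewrite sE (Bm y m By Bym).
Qed.

Definition through_line z : R -> M := fun s => torus_pt (s, z).

(** The half-leaf that arrives at the hole [y], continued by the ray. *)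
Definition absorbed_line y : R -> M :=
  fun s => if s < 0 then torus_pt (s, y) else ray_pt (s, y).

(** The uncut leaves of the torus, then the two kinds of pieces of the cut
    ones. The half-leaf that leaves the hole is parametrised by [expR]. *)
Definition blown_lines : set (set M) :=
  [set L | [\/ exists2 z, (forall m, ~ B (z + m%:~R * al)) &
                 L = range (through_line z),
               exists2 y, B y & L = range (absorbed_line y)
             | exists2 y, B y & L = range (through_line y \o expR)]].

Lemma through_path z s : unslit (s, z) ->
  @sheet_path R _ _ sheet_dom sheet (through_line z) s.
Proof.
by move=> us; exists None, z; split => //; near=> t.
Unshelve. all: by end_near. Qed.

Lemma absorbed_path y s : B y ->
  @sheet_path R _ _ sheet_dom sheet (absorbed_line y) s.
Proof.
move=> By; have [s0|s0] := ltP s 0.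
  exists None, y; split; first by apply: unslit_on_slit => //; rewrite lt_eqF.
  have : \forall t \near s, t < 0 by apply: near_lt.
  by apply: filterS => t t0; rewrite /absorbed_line t0.
exists (Some y), y; split; first by split => //=; lra.
have : \forall t \near s, -1 < t by apply: near_gt; lra.
apply: filterS => t t1; rewrite /absorbed_line; case: ltP => t0.
  rewrite sheet_off; last by left.
  rewrite /press /= subrr normr0 squash0; last by lra.
  by rewrite addrK.
by rewrite sheet_on // => -[|//] /=; lra.
Qed.

Lemma absorbed_line_inj y y' s s' : B y -> B y' ->
  absorbed_line y s = absorbed_line y' s' -> s = s' /\ exists n, y' = y + n%:~R.
Proof.
move=> By By'; rewrite /absorbed_line; case: ltP => s0; case: ltP => s'0.
- move=> /(torus_pt_inj slitB _ _) [||m [n [-> /= yE]]].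
  + by apply: unslit_on_slit => //; rewrite lt_eqF.
  + by apply: unslit_on_slit => //; rewrite lt_eqF.
  + have m0 := slit_orbit_eq By By' yE; split; first by rewrite m0 addr0.
    by exists n; rewrite yE m0 mul0r subr0.
- move=> /torus_neq_ray [] //; apply: unslit_on_slit => //.
  by rewrite lt_eqF.
- move/esym => /torus_neq_ray [] //; apply: unslit_on_slit => //.
  by rewrite lt_eqF.
- move=> /(ray_pt_inj (q := (s, y)) (q' := (s', y')) slitB By s0 By' s'0).
  by move=> [n [-> ->]]; split=> //; exists n.
Qed.

Lemma emitted_line_inj y y' s s' : B y -> B y' -> 0 < s -> 0 < s' ->
  through_line y s = through_line y' s' -> s = s' /\ exists n, y' = y + n%:~R.
Proof.
move=> By By' s0 s'0 /(torus_pt_inj slitB _ _) [||m [n [-> /= yE]]].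
- by apply: unslit_on_slit => //; rewrite gt_eqF.
- by apply: unslit_on_slit => //; rewrite gt_eqF.
have m0 := slit_orbit_eq By By' yE; split; first by rewrite m0 addr0.
by exists n; rewrite yE m0 mul0r subr0.
Qed.

Lemma absorbed_neq_emitted y y' s s' : B y -> B y' -> 0 < s' ->
  absorbed_line y s <> through_line y' s'.
Proof.
move=> By By' s'0.
have us' : unslit (s', y') by apply: unslit_on_slit => //; rewrite gt_eqF.
rewrite /absorbed_line; case: ltP => s0; last first.
  by move/esym/(torus_neq_ray us' By s0).
move=> /(torus_pt_inj slitB _ us') [|m [n [sE yE]]].
  by apply: unslit_on_slit => //; rewrite lt_eqF.
by move: sE; rewrite (slit_orbit_eq By By' yE) /= addr0 => sE; move: s'0; lra.
Qed.

Lemma sheet_line_id (gam : R -> M) :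
  (forall s, @sheet_path R _ _ sheet_dom sheet gam s) -> injective gam ->
  sheet_line (range gam).
Proof.
move=> path inj; exists gam, id, id; split => //.
  by move=> r; exact: cvg_id.
by move=> r; split; [exact: cvg_id | by [] | by near=> t].
Unshelve. all: by end_near. Qed.

Lemma blown_lines_sheet_line (L : set M) : blown_lines L -> sheet_line L.
Proof.
case=> [[z nz ->]|[y By ->]|[y By ->]].
- have uz s : unslit (s, z) by move=> m _; apply: nz.
  apply: sheet_line_id => [s|s s']; first exact: through_path.
  move=> /(torus_pt_inj slitB (uz s) (uz s')) [m [n [-> zE]]].
  rewrite (@generic_slit_irrational m n) ?addr0 //; lra.
- apply: sheet_line_id => [s|s s']; first exact: absorbed_path.
  by move=> /(absorbed_line_inj By By) [].
- have ue r : unslit (expR r, y).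
    by apply: unslit_on_slit => //; rewrite gt_eqF // expR_gt0.
  exists (through_line y), expR, (@ln R); split => //.
  + exact: continuous_expR.
  + move=> r; split; first exact/continuous_ln/expR_gt0.
      exact: expRK.
    have : \forall s \near expR r, 0 < s.
      exact/near_gt/expR_gt0.
    by apply: filterS => s s0; rewrite lnK // posrE.
  + by move=> r; apply: through_path.
  + by move=> r r' /(emitted_line_inj By By (expR_gt0 r) (expR_gt0 r')) [/expR_inj].
Qed.

Lemma blown_lines_cover (x : M) : exists2 L, blown_lines L & L x.
Proof.
have [[q uq ->]|[q [Bq q0 ->]]] := blown_torus_cover al x; last first.
  exists (range (absorbed_line q.2)); first by apply: Or32; exists q.2.
  by exists q.1; rewrite // /absorbed_line ltNge q0 -surjective_pairing.
have [[k Bk]|nk] := pselect (exists k : int, B (q.2 + k%:~R * al)); last first.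
  exists (range (through_line q.2)).
    by apply: Or31; exists q.2 => // m Bm; apply: nk; exists m.
  by exists q.1; rewrite // /through_line -surjective_pairing.
pose y := q.2 + k%:~R * al; pose s := q.1 - k%:~R.
have qE : torus_pt q = torus_pt (s, y).
  rewrite -(@torus_pt_shift R al B q (- k) 0); congr (torus_pt (_, _)).
    by rewrite mulrNz.
  by rewrite mulrNz addr0 /y; ring.
rewrite qE; have [s0|s0|s0] := ltgtP s 0.
- exists (range (absorbed_line y)); first by apply: Or32; exists y.
  by exists s; rewrite // /absorbed_line s0.
- exists (range (through_line y \o expR)); first by apply: Or33; exists y.
  by exists (ln s); rewrite // /through_line /= lnK.
- by case: (uq k) => //; apply/eqP; rewrite -subr_eq0; apply/eqP.
Qed.

Lemma blown_lines_sub (L L' : set M) (x : M) :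
  blown_lines L -> blown_lines L' -> L x -> L' x -> L `<=` L'.
Proof.
have [_ Bn _] := slitB.
have un z s : (forall m, ~ B (z + m%:~R * al)) -> unslit (s, z).
  by move=> nz m _; apply: nz.
have us s y : B y -> s < 0 -> unslit (s, y).
  by move=> By s0; apply: unslit_on_slit => //; rewrite lt_eqF.
have ue r y : B y -> unslit (expR r, y).
  by move=> By; apply: unslit_on_slit => //; rewrite gt_eqF // expR_gt0.
have free z y m n : (forall m, ~ B (z + m%:~R * al)) -> B y ->
    y = z - m%:~R * al + n%:~R -> False.
  move=> nz By yE; apply: (nz (- m)).
  have -> : z + (- m)%:~R * al = y + (- n)%:~R by rewrite yE !mulrNz; ring.
  exact: Bn.
have free' z y m n : (forall m, ~ B (z + m%:~R * al)) -> B y ->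
    z = y - m%:~R * al + n%:~R -> False.
  move=> nz By zE; apply: (free z y (- m) (- n)) => //.
  by rewrite zE !mulrNz; ring.
have absorbed_shift y n s : absorbed_line (y + n%:~R) s = absorbed_line y s.
  rewrite /absorbed_line (@ray_pt_shift R B (s, y)); case: ifP => // _.
  by rewrite -[RHS](@torus_pt_shift R al B _ 0 n) /= mul0r subr0 addr0.
case=> [[z nz ->]|[y By ->]|[y By ->]]; case=> [[z' nz' ->]|[y' By' ->]|[y' By' ->]];
  move=> [s _ <-] [s' _].
- move=> /esym/(torus_pt_inj slitB (un _ s nz) (un _ s' nz')) [m [n [_ zE]]].
  move=> _ [t _ <-]; exists (t + m%:~R) => //.
  by rewrite /through_line zE (@torus_pt_shift R al B (t, z) m n).
- rewrite /absorbed_line; case: ltP => s'0.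
    move=> /esym/(torus_pt_inj slitB (un _ s nz) (us _ _ By' s'0)) [m [n [_ zE]]].
    by case: (free z y' m n).
  by move/esym/(torus_neq_ray (un _ s nz) By' s'0).
- move=> /esym/(torus_pt_inj slitB (un _ s nz) (ue s' _ By')) [m [n [_ zE]]].
  by case: (free z y' m n).
- rewrite /absorbed_line; case: ltP => s0.
    move=> /esym/(torus_pt_inj slitB (us _ _ By s0) (un _ s' nz')) [m [n [_ zE]]].
    by case: (free' z' y m n).
  by move/(torus_neq_ray (un _ s' nz') By s0).
- move=> /(absorbed_line_inj By' By) [_ [n ->]] _ [t _ <-].
  by exists t => //; rewrite absorbed_shift.
- by move/esym/(absorbed_neq_emitted By By' (expR_gt0 _)).
- move=> /(torus_pt_inj slitB (un _ s' nz') (ue s _ By)) [m [n [_ zE]]].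
  by case: (free z' y m n).
- by move/(absorbed_neq_emitted By' By (expR_gt0 _)).
- move=> /(emitted_line_inj By' By (expR_gt0 _) (expR_gt0 _)) [_ [n ->]].
  move=> _ [t _ <-]; exists t => //.
  rewrite /through_line /= -[LHS](@torus_pt_shift R al B _ 0 n) /=.
  by rewrite mul0r subr0 addr0.
Qed.

Theorem leaf_blown_torus (L : set M) (x : M) : blown_lines L -> L x ->
  leaf blown_foliation x = L.
Proof.
apply: (leaf_sheet_line sheets).
- exact: blown_lines_sheet_line.
- exact: blown_lines_cover.
- move=> L1 L2 y H1 H2 y1 y2; apply/seteqP; split.
    exact: blown_lines_sub y1 y2.
  exact: blown_lines_sub y2 y1.
Qed.

Theorem leaf_blown_torus_homeo (x : M) :
  homeomorphic (leaf blown_foliation x) [set: R].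
Proof.
have [L LL Lx] := blown_lines_cover x.
rewrite (leaf_blown_torus LL Lx).
exact/(sheet_line_homeo sheets)/blown_lines_sheet_line.
Qed.

End LeavesOfBlownTorus.

(** * Density of the leaves and connectedness *)

Section MinimalityAndSeparation.
Context (R : realType) (al : R) (B : set R).
Hypothesis slitB : generic_slit al B.
Hypothesis B_neq0 : B !=set0.
Implicit Types (q p : R * R) (s y z e : R) (m n : int).
Local Notation M := (blown_surface al B).
Local Notation torus_pt := (@torus_pt R al B : R * R -> M).
Local Notation ray_pt := (@ray_pt R B : R * R -> M).
Local Notation unslit := (@unslit R al B).
Local Notation sheet := (@sheet R al B : option R -> R * R -> M).
Local Notation sheet_dom := (@sheet_dom R al B).

Let sheets := blown_sheets slitB.

Let tshift q m n :
  torus_pt (q.1 + m%:~R, q.2 - m%:~R * al + n%:~R) = torus_pt q.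
Proof. exact: torus_pt_shift. Qed.

Lemma open_meets_torus (U : set M) : open U -> U !=set0 ->
  exists2 q, unslit q & U (torus_pt q).
Proof.
move=> oU [x Ux].
have [i [q [dq xE]]] := sheet_cover al x.
case: i dq xE => [y|] dq xE; last first.
  by exists q => //; rewrite -[torus_pt q]/(sheet None q) xE.
have nU : nbhs (sheet (Some y) q) U by apply: open_nbhs_nbhs; rewrite xE.
have /nbhs_boxP[e e0 H] := (nbhs_sheet sheets _ dq).1 nU.
have [By q1] := dq.
(* leave the ray sideways *)
pose p := (q.1, if q.2 + e / 2 == y then q.2 - e / 2 else q.2 + e / 2).
have op : off_ray y p.
  right; rewrite /p /=; case: eqVneq => [<-|/eqP //]; lra.
have bp : box q e p.
  by apply/boxE; rewrite /p /=; case: ifP => _; split; lra.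
exists (press y p, p.2); first exact: unslit_press.
by rewrite -(sheet_off al B op); apply: H.
Qed.

(** Every open set meets the open dense torus, there in a set that contains a
    box; up to a lattice translation the box avoids the integer heights, hence
    the removed points. *)
Lemma open_contains_box (U : set M) : open U -> U !=set0 ->
  exists q e, [/\ 0 < e, box q e `<=` [set p | 0 < p.1 < 1]
    & forall p, box q e p -> U (torus_pt p)].
Proof.
move=> oU U0; have [q uq Uq] := open_meets_torus oU U0.
have nU : nbhs (sheet None q) U by apply: open_nbhs_nbhs.
have [e0 [e00 H0]] : exists e, 0 < e /\ forall p, box q e p -> U (torus_pt p).
  by have /nbhs_boxP[e ? H] := (nbhs_sheet sheets (i := None) _ uq).1 nU; exists e.
pose m := Num.floor q.1.
have m1 := floor_le q.1; have m2 := floorD1_gt q.1.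
rewrite -/m intrD in m1 m2.
pose e := Num.min (e0 / 2) ((m%:~R + 1 - q.1) / 2).
have e_gt0 : 0 < e by rewrite lt_min; apply/andP; split; lra.
have [e1 e2] : e <= e0 / 2 /\ e <= (m%:~R + 1 - q.1) / 2.
  by rewrite !ge_min !lexx orbT.
exists (q.1 + e - m%:~R, q.2 + m%:~R * al), e; split => //.
  by move=> p /boxE /= [h1 h2 _ _]; apply/andP; split; lra.
move=> p /boxE /= [h1 h2 h3 h4].
rewrite -(tshift p m 0) addr0; apply: H0; apply/boxE => /=; split; lra.
Qed.

Lemma connected_blown_surface (L : set M) : 
  dense L -> connected L -> connected [set: M].
Proof.
move=> dL cL; rewrite (_ : setT = closure L); first exact: connected_closure.
apply/seteqP; split => // x _ A; rewrite nbhsE => -[U [oU Ux] UA].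
have [y [Uy Ly]] := dL U (ex_intro _ x Ux) oU.
by exists y; split => //; apply: UA.
Qed.

Lemma through_line_continuous z s : unslit (s, z) ->
  {for s, continuous (through_line al B z)}.
Proof.
move=> us P nP.
have cs : (t, z) @[t --> s] --> (s, z).
  by apply: (@cvg_pair _ _ _ (nbhs s) (nbhs s) (nbhs z));
    [exact: cvg_id | exact: cvg_cst].
exact: (cs _ ((nbhs_sheet sheets (i := None) _ us).1 nP)).
Qed.

Definition small_multiples : Prop := forall d : R, 0 < d ->
  exists (k : nat) n, (0 < k)%N /\ 0 < k%:R * al - n%:~R < d.

(** The parameter [c] chooses the half-orbit: [k] is nonnegative if [c] is, and
    negative if [c <= -1]. A small positive multiple [d] of the angle is
    repeated until it comes close to [z - x], translated by an integer beyond
    0 on the chosen side. *)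
Lemma orbit_near (c x z e : R) : small_multiples -> 0 < e ->
  exists k n, `|x + k%:~R * al + n%:~R - z| < e /\
    (0 <= c -> 0 <= k) /\ (c <= -1 -> k <= -1).
Proof.
move=> sm e0; have [k [n [k0 /andP[d0 d1]]]] := sm e e0.
pose d := k%:R * al - n%:~R; rewrite -/d in d0 d1.
have [N [N0 N1]] : exists N : int, (0 <= c -> 0 <= z - x + N%:~R) /\
    (c <= -1 -> z - x + N%:~R < 0).
  have /andP[f0 f1] := frac_part_itv (z - x).
  have [c0|c0] := leP 0 c.
    exists (- Num.floor (z - x)); rewrite mulrNz; split=> // ?; lra.
  exists (- Num.floor (z - x) - 1); rewrite intrD !mulrNz.
  by split=> ?; move: f0 f1; rewrite /frac_part; lra.
pose f := Num.floor ((z - x + N%:~R) / d).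
have f1 : f%:~R * d <= z - x + N%:~R by rewrite -ler_pdivlMr // floor_le.
have f2 : z - x + N%:~R < f%:~R * d + d.
  have := floorD1_gt ((z - x + N%:~R) / d).
  by rewrite -/f ltr_pdivrMr // intrD mulrDl mul1r.
exists (f * k%:Z), (- (f * n) - N); split; last split.
- rewrite intrM intrD !mulrNz intrM.
  have -> : x + f%:~R * k%:~R * al + (- (f%:~R * n%:~R) - N%:~R) - z =
    f%:~R * d - (z - x + N%:~R) by rewrite /d; ring.
  by rewrite ltr_norml; apply/andP; split; lra.
- move=> /N0 h; apply: mulr_ge0 => //.
  by rewrite floor_ge0 divr_ge0 // ltW.
- move=> /N1 h; have f0 : f < 0.
    by rewrite floor_lt0 pmulr_llt0 // invr_gt0.
  by nia.
Qed.

(** Each line contains a half-orbit of the rotation at every height strictly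
    between 0 and 1: the forward one for a half-leaf that leaves a hole, the
    backward one for a half-leaf that is absorbed by a ray. *)
Lemma blown_lines_dense (L : set M) : small_multiples ->
  blown_lines L -> dense L.
Proof.
move=> sm LL U U0 oU; have [q [e [e0 b01 H]]] := open_contains_box oU U0.
have meet (c x : R) : exists k n, [/\ U (torus_pt (q.1 + k%:~R, x)),
    0 < q.1 < 1, 0 <= c -> 0 <= k & c <= -1 -> k <= -1].
  have [k [n [kn [k0 k1]]]] := orbit_near c x q.2 sm e0.
  exists k, n; split => //; last exact: b01 (boxq q e0).
  rewrite -(tshift _ (- k) n) mulrNz /= addrK; apply: H.
  move: kn; rewrite ltr_distl => /andP[h1 h2].
  by apply/boxE => /=; rewrite mulNr opprK; split; lra.
case: LL => [[z nz ->]|[y By ->]|[y By ->]].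
- have [k [n [Uk _ _ _]]] := meet 0 z.
  by exists (torus_pt (q.1 + k%:~R, z)); split => //; exists (q.1 + k%:~R).
- have [k [n [Uk /andP[q0 q1] _ k1]]] := meet (-1) y.
  exists (torus_pt (q.1 + k%:~R, y)); split => //; exists (q.1 + k%:~R) => //.
  rewrite /absorbed_line; have : k%:~R <= -1 :> R.
    by rewrite -[-1]/((-1)%:~R) ler_int k1.
  by move=> kR; rewrite ifT //; lra.
- have [k [n [Uk /andP[q0 q1] k0 _]]] := meet 0 y.
  have : 0 <= k%:~R :> R by rewrite ler0z k0.
  move=> k0R; exists (torus_pt (q.1 + k%:~R, y)); split => //.
  exists (ln (q.1 + k%:~R)) => //.
  by rewrite /through_line /= lnK // posrE; lra.
Qed.

Lemma blown_surface_connected : small_multiples -> connected [set: M].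
Proof.
move=> sm; have [y By] := B_neq0.
apply: (@connected_blown_surface (range (through_line al B y \o expR))).
  by apply: blown_lines_dense => //; apply: Or33; exists y.
apply: connected_continuous_connected; first exact/connected_intervalP.
rewrite continuous_open_subspace; last exact: openT.
move=> r _.
have cr : expR t @[t --> r] --> expR r by exact: continuous_expR.
apply: (cvg_comp _ _ cr); apply: through_line_continuous.
by apply: (unslit_on_slit slitB) => //; rewrite gt_eqF // expR_gt0.
Qed.

End MinimalityAndSeparation.

(** * The Hausdorff property *)

Section Separation.
Context (R : realType) (al : R) (B : set R).
Hypothesis slitB : generic_slit al B.
Implicit Types (q p : R * R) (s y z e : R) (m n : int).
Local Notation M := (blown_surface al B).
Local Notation torus_pt := (@torus_pt R al B : R * R -> M).
Local Notation ray_pt := (@ray_pt R B : R * R -> M).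
Local Notation unslit := (@unslit R al B).
Local Notation sheet := (@sheet R al B : option R -> R * R -> M).
Local Notation sheet_dom := (@sheet_dom R al B).

Let sheets := blown_sheets slitB.

Let tshift q m n :
  torus_pt (q.1 + m%:~R, q.2 - m%:~R * al + n%:~R) = torus_pt q.
Proof. exact: torus_pt_shift. Qed.

Lemma noninteger_gap x : (forall n, x <> n%:~R) ->
  exists2 e : R, 0 < e & forall n, e <= `|x - n%:~R|.
Proof.
move=> xn; have f1 := floor_le x; have f2 := floorD1_gt x.
pose m := Num.floor x; rewrite -/m in f1 f2.
have f3 : m%:~R < x by rewrite lt_neqAle f1 andbT; apply/eqP => /esym /xn.
exists (Num.min (x - m%:~R) ((m + 1)%:~R - x)).
  by rewrite lt_min; apply/andP; split; lra.
move=> n; have [nm|mn] := leP n m.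
  have : n%:~R <= m%:~R :> R by rewrite ler_int.
  by move=> ?; rewrite ger0_norm ?ge_min; last lra; apply/orP; left; lra.
have : (m + 1)%:~R <= n%:~R :> R by rewrite ler_int lezD1.
by move=> ?; rewrite ler0_norm ?ge_min; last lra; apply/orP; right; lra.
Qed.

Definition separable_pts (x x' : M) : Prop :=
  exists A A' : set M, [/\ nbhs x A, nbhs x' A' & forall t, A t -> ~ A' t].

Lemma separable_pts_sym x x' : separable_pts x x' -> separable_pts x' x.
Proof. by move=> [A [A' [? ? H]]]; exists A', A; split => // t A't /H. Qed.

Lemma separate_boxes i i' q q' e : 0 < e -> sheet_dom i q -> sheet_dom i' q' ->
  (forall p p', box q e p -> box q' e p' -> sheet_dom i p -> sheet_dom i' p' ->
    sheet i p <> sheet i' p') ->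
  separable_pts (sheet i q) (sheet i' q').
Proof.
move=> e0 dq dq' H.
have nb j r : sheet_dom j r ->
    nbhs (sheet j r) (sheet j @` (box r e `&` sheet_dom j)).
  move=> dr; apply/(nbhs_sheet sheets _ dr).
  have n1 := open_nbhs_nbhs (conj (@open_box_open _ r e) (boxq r e0)).
  have n2 := open_nbhs_nbhs (conj (@open_sheet_dom R al B slitB j) dr).
  by apply: filterS2 n1 n2 => t t1 t2; exists t.
exists (sheet i @` (box q e `&` sheet_dom i)),
  (sheet i' @` (box q' e `&` sheet_dom i')).
split; [exact: nb | exact: nb |].
by move=> _ [p [p1 p2] <-] [p' [p1' p2']] /esym; apply: H.
Qed.

Lemma ray_sheets_meet y y' p p' : sheet_dom (Some y) p -> sheet_dom (Some y') p' ->
  sheet (Some y) p = sheet (Some y') p' -> exists n, p'.2 = p.2 + n%:~R.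
Proof.
move=> [By p1] [By' p'1].
have [op|/[dup] nop /not_off_ray [p0 py]] := pselect (off_ray y p);
have [op'|/[dup] nop' /not_off_ray [p'0 p'y]] := pselect (off_ray y' p').
- rewrite !sheet_off // => /(torus_pt_inj slitB _ _)[||m [n [pE1 pE2]]].
  + exact: unslit_press.
  + exact: unslit_press.
  have /andP[h1 h2] := press_itv p1 op; have /andP[h1' h2'] := press_itv p'1 op'.
  exists n; rewrite pE2 (@small_int R m) ?mul0r ?subr0 //.
  by rewrite ltr_norml; apply/andP; split; lra.
- rewrite sheet_off // sheet_on // => /(torus_pt_neq_ray_pt slitB).
  by case=> //; [exact: unslit_press | rewrite p'y].
- rewrite sheet_on // sheet_off // => /esym/(torus_pt_neq_ray_pt slitB).
  by case=> //; [exact: unslit_press | rewrite py].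
- rewrite !sheet_on // => /(ray_pt_inj slitB _ p0 _ p'0) []; rewrite ?py ?p'y //.
  by move=> n pE; exists n; rewrite -p'y pE.
Qed.

Lemma separate_ray_sheets y y' q q' : sheet_dom (Some y) q ->
  sheet_dom (Some y') q' -> (forall n, q'.2 <> q.2 + n%:~R) ->
  separable_pts (sheet (Some y) q) (sheet (Some y') q').
Proof.
move=> dq dq' qn.
have [|e e0 gap] := @noninteger_gap (q'.2 - q.2).
  by move=> n h; apply: (qn n); lra.
apply: (@separate_boxes _ _ _ _ (e / 2)) => //; first lra.
move=> p p' /boxE[_ _ b1 b2] /boxE[_ _ b3 b4] dp dp'.
move=> /(ray_sheets_meet dp dp') [n nE].
have := gap n; apply/negP; rewrite -ltNge ltr_norml; apply/andP; split; lra.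
Qed.

Lemma separate_same_ray_sheet y q q' : sheet_dom (Some y) q ->
  sheet_dom (Some y) q' -> q'.2 = q.2 -> q'.1 != q.1 ->
  separable_pts (sheet (Some y) q) (sheet (Some y) q').
Proof.
move=> dq dq' q2 q1; pose e := Num.min (1 / 2) (`|q'.1 - q.1| / 2).
have d0 : 0 < `|q'.1 - q.1| by rewrite normr_gt0 subr_eq0.
have e0 : 0 < e by rewrite lt_min; apply/andP; split; lra.
have [e1 e2] : e <= 1 / 2 /\ e <= `|q'.1 - q.1| / 2.
  by rewrite !ge_min !lexx orbT.
apply: (@separate_boxes _ _ _ _ e) => //.
move=> p p' /boxE[b1 b2 b3 b4] /boxE[b1' b2' b3' b4'] dp dp' pp'.
have E : p = p'.
  apply: (sheet_some_inj slitB dp dp' _ pp').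
  by rewrite ltr_norml; apply/andP; split; lra.
subst p'; have : `|q'.1 - q.1| < 2 * e by rewrite ltr_norml; apply/andP; split; lra.
lra.
Qed.

(** Lattice translates of a point do not accumulate: either the heights differ
    by a non-integer, or one may assume that they agree, and then the
    transverse coordinates differ by a non-integer. *)
Lemma separate_torus q q' : unslit q -> unslit q' -> torus_pt q <> torus_pt q' ->
  separable_pts (torus_pt q) (torus_pt q').
Proof.
move=> uq uq' qq'.
have [[m mE]|nm] := pselect (exists m, q'.1 = q.1 + m%:~R); last first.
  have [|e e0 gap] := @noninteger_gap (q'.1 - q.1).
    by move=> n h; apply: nm; exists n; lra.
  apply: (@separate_boxes None None _ _ (e / 2)) => //; first lra.
  move=> p p' /boxE[b1 b2 _ _] /boxE[b3 b4 _ _] dp dp'.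
  move=> /(torus_pt_inj slitB dp dp') [m [n pE]].
  move: b3 b4; rewrite pE /= => b3 b4.
  have := gap m; apply/negP; rewrite -ltNge ltr_norml; apply/andP; split; lra.
pose r := (q'.1 + (- m)%:~R, q'.2 - (- m)%:~R * al + 0%:~R).
have rE : torus_pt r = torus_pt q' by exact: tshift.
have ur : unslit r by exact: unslit_shift.
have r1 : r.1 = q.1 by rewrite /= mE mulrNz addrK.
rewrite -rE in qq' *; clearbody r; clear rE uq' q' mE.
have [|e e0 gap] := @noninteger_gap (r.2 - q.2).
  move=> n h; apply: qq'; rewrite -(tshift q 0 n) mul0r subr0 addr0.
  by congr (torus_pt _); rewrite [RHS]surjective_pairing r1; congr (_, _); lra.
pose d := Num.min (1 / 2) (e / 2).
have d0 : 0 < d by rewrite lt_min; apply/andP; split; lra.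
have [d1 d2] : d <= 1 / 2 /\ d <= e / 2 by rewrite !ge_min !lexx orbT.
apply: (@separate_boxes None None _ _ d) => //.
move=> p p' /boxE[b1 b2 b3 b4] /boxE[b1' b2' b3' b4'] dp dp'.
move=> /(torus_pt_inj slitB dp dp') [k [n pE]].
move: b1' b2' b3' b4'; rewrite pE /= r1 => b1' b2'.
have -> : k = 0.
  by apply: (@small_int R); rewrite ltr_norml; apply/andP; split; lra.
rewrite mul0r subr0 => b3' b4'.
have := gap n; apply/negP; rewrite -ltNge ltr_norml; apply/andP; split; lra.
Qed.

(** The one case in which the two points lie in no common sheet and the
    transverse coordinates may not suffice: past the circle, a neighbourhood
    of [q] continues at the bottom of other columns of the torus, but close to
    the ray only the top halves of columns are involved. *)
Lemma separate_seam_ray q q' : unslit q -> q.1 = 0 -> B q'.2 -> 0 <= q'.1 ->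
  separable_pts (torus_pt q) (ray_pt q').
Proof.
have [_ Bn _] := slitB.
move=> uq q0 Bq' q'0.
have [|e e0 gap] := @noninteger_gap (q'.2 - q.2).
  move=> n h; apply: (uq 0); rewrite ?q0 // mul0r addr0.
  have -> : q.2 = q'.2 + (- n)%:~R by rewrite mulrNz -h; ring.
  exact: Bn.
have nq' : ~ off_ray q'.2 q' by case=> [|//]; lra.
rewrite -(sheet_on al B nq').
pose d := Num.min (1 / 4) (e / 2).
have d0 : 0 < d by rewrite lt_min; apply/andP; split; lra.
have [d1 d2] : d <= 1 / 4 /\ d <= e / 2 by rewrite !ge_min !lexx orbT.
apply: (@separate_boxes None (Some q'.2) _ _ d) => //; first by split => //=; lra.
move=> p p' /boxE[b1 b2 b3 b4] /boxE[b1' b2' b3' b4'] dp [_ p'1].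
rewrite -[sheet None p]/(torus_pt p).
have [op'|nop'] := pselect (off_ray q'.2 p'); last first.
  have [p'0 p'y] := not_off_ray nop'.
  by rewrite sheet_on //; apply: (torus_pt_neq_ray_pt slitB); rewrite ?p'y.
have up' := @unslit_press R al B q'.2 p' p'.2 p'1 op'.
rewrite sheet_off // => /(torus_pt_inj slitB dp up') [m [n [pE1 pE2]]].
have /andP[_ h2] := press_itv p'1 op'.
(* in the chart of the ray, a point near the ray is at height at least -1/2 *)
have h1 : - (1 / 2) <= press q'.2 p'.
  have : 1 / 2 <= squash `|p'.2 - q'.2| (p'.1 + 1).
    apply: squash_ge_half; last by lra.
    by rewrite normr_ge0 ler_norml; apply/andP; split; lra.
  by rewrite /press; lra.
have m0 : m = 0.
  by apply: (@small_int R); rewrite ltr_norml; apply/andP; split; lra.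
move: pE2; rewrite m0 mul0r subr0 => pE2.
have := gap n; apply/negP; rewrite -ltNge ltr_norml; apply/andP; split; lra.
Qed.

(** A point of the torus off the circle can be seen, after a lattice
    translation, in the sheet of the ray. *)
Lemma separate_torus_ray q q' : unslit q -> B q'.2 -> 0 <= q'.1 ->
  separable_pts (torus_pt q) (ray_pt q').
Proof.
move=> uq Bq' q'0.
have nq' : ~ off_ray q'.2 q' by case=> [|//]; lra.
have dq' : sheet_dom (Some q'.2) q' by split=> //=; lra.
pose m := - Num.floor q.1.
have [q1|q1] := eqVneq q.1 (Num.floor q.1)%:~R.
  rewrite -(tshift q m 0); apply: separate_seam_ray => //.
    exact: unslit_shift.
  by rewrite /= mulrNz -q1 subrr.
pose r := (q.1 + (m - 1)%:~R, q.2 - (m - 1)%:~R * al + 0%:~R).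
have rE : torus_pt r = torus_pt q by exact: tshift.
have r1 : -1 < r.1 < 0.
  have f1 := floor_le q.1; have := floorD1_gt q.1.
  have f3 : (Num.floor q.1)%:~R < q.1 by rewrite lt_neqAle eq_sym q1 f1.
  by rewrite /r /m /= !intrD !mulrNz => f2; apply/andP; split; lra.
rewrite -rE; clearbody r; clear rE.
have shiftE n : torus_pt (r.1, r.2 + n%:~R) = torus_pt r.
  by rewrite -(tshift r 0 n) mul0r subr0 addr0.
have in_sheet t : -1 < t.1 < 0 ->
    sheet (Some q'.2) (unpress q'.2 t, t.2) = torus_pt t.
  move=> /[dup] t1 /andP[_ t0].
  rewrite (sheet_off al B (off_ray_unpress q'.2 t0)).
  by rewrite unpressK // -surjective_pairing.
have in_dom t : -1 < t.1 < 0 -> sheet_dom (Some q'.2) (unpress q'.2 t, t.2).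
  by move=> /andP[t1 _]; split => //; exact: unpress_gt.
have [[n nE]|nn] := pselect (exists n, q'.2 = r.2 + n%:~R).
  rewrite -(shiftE n) -nE -(in_sheet (r.1, q'.2)) // -(sheet_on al B nq').
  apply: separate_same_ray_sheet => //; first exact: in_dom.
  rewrite /unpress /= subrr normr0 stretch0 addrK.
  by rewrite gt_eqF //; lra.
rewrite -(in_sheet r) // -(sheet_on al B nq'); apply: separate_ray_sheets => //.
  exact: in_dom.
by move=> n nE; apply: nn; exists n.
Qed.

Lemma separate_rays q q' : B q.2 -> 0 <= q.1 -> B q'.2 -> 0 <= q'.1 ->
  ray_pt q <> ray_pt q' -> separable_pts (ray_pt q) (ray_pt q').
Proof.
move=> Bq q0 Bq' q'0 qq'.
have on_ray (r : R * R) : 0 <= r.1 -> ~ off_ray r.2 r by move=> r0 [|//]; lra.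
have dom (r : R * R) : B r.2 -> 0 <= r.1 -> sheet_dom (Some r.2) r.
  by move=> Br r0; split => //=; lra.
have [[n nE]|nn] := pselect (exists n, q.2 = q'.2 + n%:~R); last first.
  rewrite -(sheet_on al B (on_ray q q0)) -(sheet_on al B (on_ray q' q'0)).
  apply: separate_ray_sheets; [exact: dom | exact: dom |].
  move=> n nE; apply: nn; exists (- n); rewrite nE mulrNz; ring.
pose r := (q'.1, q.2).
have rE : ray_pt q' = ray_pt r.
  by rewrite /r nE; exact/esym/ray_pt_shift.
rewrite rE in qq' *.
have nr : ~ off_ray q.2 r by case=> [/=|//]; lra.
rewrite -(sheet_on al B (on_ray q q0)) -(sheet_on al B nr).
apply: separate_same_ray_sheet => //; [exact: dom | by split => //=; lra |].
apply/eqP => r1; apply: qq'; congr (ray_pt _).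
by rewrite [q]surjective_pairing /r -r1.
Qed.

Theorem blown_surface_hausdorff : hausdorff_space M.
Proof.
move=> x x' xx'; apply: contrapT => neq.
suff [A [A' [nA nA' dis]]] : separable_pts x x'.
  by have [y [Ay A'y]] := xx' A A' nA nA'; exact: dis Ay A'y.
have [[q uq xE]|[q [Bq q0 xE]]] := blown_torus_cover al x;
have [[q' uq' x'E]|[q' [Bq' q'0 x'E]]] := blown_torus_cover al x';
rewrite {}xE {}x'E in neq *; clear xx'.
- exact: separate_torus.
- exact: separate_torus_ray.
- by apply/separable_pts_sym; exact: separate_torus_ray.
- exact: separate_rays.
Qed.

End Separation.

(** * A separable surface with an uncountable discrete family *)

Lemma no_injection_to_nat (g : (nat -> bool) -> nat) : ~ injective g.
Proof.
move=> inj; pose f n := ~~ `[< exists2 b, g b = n & b n >].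
have [[b gb bn]|nb] := pselect (exists2 b, g b = g f & b (g f)).
  have fn : f (g f) by rewrite -{1}(inj _ _ gb).
  by move: (fn); rewrite {1}/f => /asboolPn; apply; exists f.
have fn : f (g f) by apply/asboolPn.
by apply: nb; exists f.
Qed.

(** In a metric, each [P b] is isolated from the others by a ball of radius
    [2 / (n + 1)], and some [D t] lies at distance less than [1 / (n + 1)] from
    [P b]. The pair of [n] and [t] determines [b], but there are only countably
    many such pairs. *)
Lemma not_metrizable_discrete_family (R : realType) (M : topologicalType)
    (T : countType) (D : T -> M) (P : (nat -> bool) -> M)
    (U : (nat -> bool) -> set M) :
  (forall V : set M, open V -> V !=set0 -> exists t, V (D t)) ->
  (forall b, open (U b)) -> (forall b, U b (P b)) ->
  (forall b b', U b (P b') -> b = b') -> ~ metrizable R M.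
Proof.
move=> dD oU UP inj [d [d0 dE dC dT dO]].
have oball x e : open [set y | d x y < e].
  apply/dO => y /= xy; exists (e - d x y); first by rewrite subr_gt0.
  by move=> z /= yz; have := dT x y z; lra.
have pick b : exists nt : nat * T,
    d (P b) (D nt.2) < nt.1.+1%:R^-1 /\
    [set y | d (P b) y < 2 * nt.1.+1%:R^-1] `<=` U b.
  have [e e0 sub] := (dO (U b)).1 (oU b) (P b) (UP b).
  pose n := Num.trunc (2 / e).
  have n2 : 2 * n.+1%:R^-1 < e.
    rewrite ltr_pdivrMr ?ltr0Sn // mulrC -ltr_pdivrMr //.
    exact: truncnS_gt.
  have [|t Dt] := dD _ (oball (P b) n.+1%:R^-1).
    by exists (P b); rewrite /= (dE _ _).2 // invr_gt0 ltr0Sn.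
  by exists (n, t); split => // y yn; apply: sub; exact: lt_trans yn n2.
pose g b := projT1 (cid (pick b)).
suff inj_g : injective (choice.pickle \o g) by exact: no_injection_to_nat inj_g.
move=> b b' /(pcan_inj choice.pickleK) gE.
apply: inj; have [h1 h2] := projT2 (cid (pick b)).
have [h1' _] := projT2 (cid (pick b')).
apply: h2; apply: le_lt_trans (dT _ (D (g b).2) _) _.
rewrite -/(g b) in h1 *; rewrite -/(g b') -gE in h1'.
by rewrite (dC (D _)) mulr_natl mulr2n ltrD.
Qed.

Theorem blown_surface_not_metrizable (R : realType) (al : R) (B : set R)
    (c : (nat -> bool) -> R) : generic_slit al B -> (forall b, B (c b)) ->
  (forall b b' (n : int), c b - c b' = n%:~R -> b = b') ->
  ~ metrizable R (blown_surface al B).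
Proof.
move=> slitB Bc c_inj; set M := blown_surface al B.
have sheets := blown_sheets slitB.
pose D (r : rat * rat) : M := torus_pt al B (ratr r.1, ratr r.2).
pose U b : set M := sheet al B (Some (c b)) @` sheet_dom al B (Some (c b)).
have dom b : sheet_dom al B (Some (c b)) (0, c b) by split => //=; lra.
have on_ray b : ~ off_ray (c b) (0, c b) by case=> /=; rewrite ?ltxx.
apply: (@not_metrizable_discrete_family _ _ _ D (fun b => ray_pt B (0, c b)) U).
- move=> V oV V0; have [q [e [e0 _ H]]] := open_contains_box slitB oV V0.
  have [|r1] := @rat_in_itvoo R (q.1 - e) (q.1 + e); first by lra.
  rewrite in_itv /= => /andP[? ?].
  have [|r2] := @rat_in_itvoo R (q.2 - e) (q.2 + e); first by lra.
  rewrite in_itv /= => /andP[? ?].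
  by exists (r1, r2); apply: H; apply/boxE; split.
- by move=> b; apply: (open_sheet sheets) => //; exact: open_sheet_dom.
- by move=> b; exists (0, c b) => //; rewrite sheet_on.
- move=> b b' [p [_ p1]].
  have [op|nop] := pselect (off_ray (c b) p).
    rewrite sheet_off // => /(torus_pt_neq_ray_pt slitB) [] //.
    - exact: unslit_press.
    - exact: Bc.
  have [p0 py] := not_off_ray nop.
  rewrite sheet_on // => /(ray_pt_inj slitB _ p0 _ _) []; rewrite ?py //.
    exact: Bc.
  move=> n [_ bE]; apply/esym/(c_inj _ _ n).
  by rewrite bE; ring.
Qed.

Theorem theorem1p6 (R : realType) :
  exists M : topologicalType,
    [/\ surface R M, ~ metrizable R M
      & exists F : set (chart R M),
          [/\ foliation F, minimal_foliation F
            & forall x : M, homeomorphic (leaf F x) [set: R]]].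
Proof.
have slit : generic_slit (rot_angle R) (@near_int_set R).
  split.
  - exact: closed_near_int_set.
  - exact: near_int_setDz.
  - exact: near_int_set_orbit.
have slit0 : @near_int_set R !=set0.
  by exists (code R (fun=> false)); exact: near_int_set_code.
have sm : small_multiples (rot_angle R) by exact: rot_angle_small_multiple.
have sheets := blown_sheets slit.
exists (blown_surface (rot_angle R) (@near_int_set R)); split.
- split.
  + exact: blown_surface_connected.
  + exact: blown_surface_hausdorff.
  + exact: (locally_euclidean_glued sheets).
- apply: (@blown_surface_not_metrizable R _ _ (code R)) => //.
  + exact: near_int_set_code.
  + exact: code_inj.
- exists (@blown_foliation R (rot_angle R) (@near_int_set R)); split.
  + exact: (sheet_foliationP sheets).
  + move=> x; have [L LL Lx] := blown_lines_cover x.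
    by rewrite (leaf_blown_torus slit slit0 LL Lx); apply: blown_lines_dense.
  + exact: leaf_blown_torus_homeo.
Qed.
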